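(* Let $\varepsilon > 0$ and let $\mathcal{C}:[0,1]\to M_n$ be a matrix path with $\mathcal{C}$-eigenpath set $\{\gamma_1, \ldots, \gamma_n\}$. Then there is a matrix path $\mathcal{C}':[0,1]\to M_n$ admitting a unique $\mathcal{C}'$-eigenpath set $\{\gamma_1', \ldots, \gamma_n'\}$ such that $\|\mathcal{C}_\alpha - \mathcal{C}'_\alpha\| < \varepsilon$ and $|\gamma_j(\alpha) - \gamma_j'(\alpha)| < \varepsilon$ for all $\alpha \in [0,1]$ and $j=1,\ldots,n$ (for a suitable indexing of the $\gamma_j'$).
   Context: $M_n$ is the space of $n\times n$ complex matrices, with norm $\|A\|=\max_{i,j}|a_{i,j}|$. A matrix path is a continuous function $\mathcal{C}:[0,1]\to M_n$, with value $\mathcal{C}_\alpha$ at $\alpha$. $\Sigma(A)$ denotes the spectrum of $A\in M_n$ as a multiset of size $n$ (eigenvalues with algebraic multiplicity). A $\mathcal{C}$-eigenpath set is a multiset $\{\gamma_1,\ldots,\gamma_n\}$ of continuous functions $\gamma_j:[0,1]\to\mathbb{C}$ (possibly not all distinct) such that $\Sigma(\mathcal{C}_\alpha)=\{\gamma_1(\alpha),\ldots,\gamma_n(\alpha)\}$ as multisets for all $\alpha\in[0,1]$. Uniqueness of an eigenpath set is uniqueness as a multiset of functions. *)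

(* Defs.v *)
From HB Require Import structures.
From mathcomp Require Import all_boot all_order all_fingroup all_algebra.
From mathcomp Require Import complex.
From mathcomp Require Import all_classical all_reals all_analysis.

Set Implicit Arguments.
Unset Strict Implicit.
Unset Printing Implicit Defensive.

Import Order.TTheory GRing.Theory Num.Theory.
Import numFieldNormedType.Exports.

Local Open Scope classical_set_scope.
Local Open Scope ring_scope.
Local Open Scope complex_scope.

(* R[i] carries the topology of its modulus, as every numFieldType does; the
   instance is needed for inference keyed on the head constant [complex]. The
   norm of 'M[R[i]]_n is then the largest modulus of an entry. *)
HB.instance Definition _ (R : realType) :=
  NormedModule.copy R[i] (R[i] : numClosedFieldType)^o.

Section Eigenpaths.
Variables (R : realType) (n : nat).

(* Paths are total functions on R whose values outside [0, 1] are irrelevant. *)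
Definition matrix_path (C : R -> 'M[R[i]]_n) : Prop :=
  {within `[0, 1], continuous C}.

(* Sequences up to perm_eq stand for multisets. *)
Definition spectrum (A : 'M[R[i]]_n) : seq R[i] :=
  sval (closed_field_poly_normal (char_poly A)).

Lemma char_poly_spectrum (A : 'M[R[i]]_n) :
  char_poly A = \prod_(z <- spectrum A) ('X - z%:P).
Proof.
rewrite /spectrum; case: closed_field_poly_normal => r /= {1}->.
by rewrite (monicP (char_poly_monic A)) scale1r.
Qed.

Lemma size_spectrum (A : 'M[R[i]]_n) : size (spectrum A) = n.
Proof.
apply/eqP; rewrite -eqSS -(size_prod_XsubC (spectrum A) id).
by rewrite -char_poly_spectrum size_char_poly.
Qed.

(* The family gamma is an indexing of the multiset. *)
Definition eigenpath_set (C : R -> 'M[R[i]]_n) (gamma : 'I_n -> R -> R[i]) :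
    Prop :=
  (forall j, {within `[0, 1], continuous (gamma j)}) /\
  (forall a, a \in `[0, 1] ->
     perm_eq (spectrum (C a)) [seq gamma j a | j <- enum 'I_n]).

(* Equality of multisets of functions on [0, 1]: one permutation of the indices
   serves every point of the interval. *)
Definition same_eigenpaths (gamma eta : 'I_n -> R -> R[i]) : Prop :=
  exists s : 'S_n, forall j, {in `[0, 1], eta j =1 gamma (s j)}.

Definition unique_eigenpath_set (C : R -> 'M[R[i]]_n)
    (gamma : 'I_n -> R -> R[i]) : Prop :=
  eigenpath_set C gamma /\
  (forall eta, eigenpath_set C eta -> same_eigenpaths gamma eta).

End Eigenpaths.

(* Main.v *)
(* A path can be replaced, on a short interval around t, by anything close to
   M := C t whose eigenvalues are labelled close to m := gamma t. Hence it is
   enough to join any two matrices X, Y near M with simple, labelled spectra near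
   m by a path of such matrices that stays near M and respects the labels. A path
   with simple spectrum has a unique eigenpath set.
   On the line from X to Y the discriminant is a polynomial, so a small detour in
   the complex parameter avoids its zeros and keeps the spectrum simple, but the
   labels may come back permuted within clusters. To correct this, perturb M into
   a cyclic matrix with the same spectrum m. Conjugated companion matrices then
   give a continuous symmetric section x |-> S x of the spectrum map near M, and a
   path of distinct labels from z0 o s to z0 gives a loop at S z0 permuting the
   eigenvalues by s. Both X and Y are therefore joined to S z0. *)
Require Import Defs.
From mathcomp Require Import all_boot all_order all_fingroup all_algebra.
From mathcomp Require Import complex.
From mathcomp Require Import all_classical all_reals all_analysis.
From mathcomp Require Import separable.
From mathcomp Require Import ring lra zify.

Set Implicit Arguments.
Unset Strict Implicit.
Unset Printing Implicit Defensive.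

Import Order.TTheory GRing.Theory Num.Theory.
Import numFieldNormedType.Exports.
Local Open Scope classical_set_scope.
Local Open Scope ring_scope.
Local Open Scope complex_scope.

(** * Real-valued norms and limits over R[i] *)

Section RealNorm.
Variable R : realType.

(** The norm of a module over [R[i]] is itself an element of [R[i]], whose order is only partial.
    Its real part carries the same information and moves every estimate to the ordered field [R]. *)
Definition rnorm (V : normedModType R[i]) (x : V) : R := complex.Re `|x|.

Lemma rnormE (V : normedModType R[i]) (x : V) : `|x| = (rnorm x)%:C.
Proof.
rewrite /rnorm; have : 0 <= `|x| := normr_ge0 x.
by case: `|x| => a b; rewrite lecE /= => /andP[/eqP -> _].
Qed.

Lemma rnorm_le (V : normedModType R[i]) (x : V) (e : R) :
  (`|x| <= e%:C) = (rnorm x <= e).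
Proof. by rewrite rnormE lecR. Qed.

Lemma rnorm_lt (V : normedModType R[i]) (x : V) (e : R) :
  (`|x| < e%:C) = (rnorm x < e).
Proof. by rewrite rnormE ltcR. Qed.

Lemma rnorm_ge0 (V : normedModType R[i]) (x : V) : 0 <= rnorm x.
Proof. by rewrite -lecR -rnormE normr_ge0. Qed.

Lemma rnorm0 (V : normedModType R[i]) : rnorm (0 : V) = 0.
Proof. by rewrite /rnorm normr0. Qed.

Lemma rnorm_eq0 (V : normedModType R[i]) (x : V) : (rnorm x == 0) = (x == 0).
Proof.
apply/eqP/eqP => [h|->]; last exact: rnorm0.
by apply/eqP; rewrite -normr_eq0 rnormE h.
Qed.

Lemma rnormN (V : normedModType R[i]) (x : V) : rnorm (- x) = rnorm x.
Proof. by rewrite /rnorm normrN. Qed.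

Lemma rdistC (V : normedModType R[i]) (x y : V) : rnorm (x - y) = rnorm (y - x).
Proof. by rewrite /rnorm distrC. Qed.

Lemma rnormD (V : normedModType R[i]) (x y : V) :
  rnorm (x + y) <= rnorm x + rnorm y.
Proof. by rewrite -lecR rmorphD /= -!rnormE ler_normD. Qed.

Lemma rdistD (V : normedModType R[i]) (y x z : V) :
  rnorm (x - z) <= rnorm (x - y) + rnorm (y - z).
Proof. by rewrite -[x - z](subrKA y) rnormD. Qed.

Lemma rnormM (x y : R[i]) : rnorm (x * y) = rnorm x * rnorm y.
Proof. by apply: complexI; rewrite rmorphM /= -!rnormE normrM. Qed.

Lemma rnormZ (V : normedModType R[i]) (z : R[i]) (x : V) :
  rnorm (z *: x) = rnorm z * rnorm x.
Proof. by apply: complexI; rewrite rmorphM /= -!rnormE normrZ. Qed.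

Lemma rnormR (x : R) : rnorm x%:C = `|x|.
Proof.
by rewrite /rnorm normc_def /= expr0n /= addr0 sqrtr_sqr.
Qed.

Lemma rnorm_sum (V : normedModType R[i]) (I : Type) (r : seq I) (P : pred I)
    (F : I -> V) :
  rnorm (\sum_(i <- r | P i) F i) <= \sum_(i <- r | P i) rnorm (F i).
Proof.
elim/big_ind2: _ => [|x a y b xa yb|//]; first by rewrite rnorm0.
by apply: le_trans (rnormD _ _) _; apply: lerD.
Qed.

Lemma rnorm_prod (I : Type) (r : seq I) (P : pred I) (F : I -> R[i]) :
  rnorm (\prod_(i <- r | P i) F i) = \prod_(i <- r | P i) rnorm (F i).
Proof.
apply: (big_morph (@rnorm R[i])); first exact: rnormM.
by rewrite -[1]/(1%:C) rnormR normr1.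
Qed.

Lemma cvg_rnorm (V : normedModType R[i]) {T : Type} {F : set_system T}
    {FF : Filter F} (f : T -> V) (y : V) :
  f @ F --> y <-> forall e : R, 0 < e -> \forall t \near F, rnorm (y - f t) < e.
Proof.
split.
  move=> /cvgrPdist_lt h e e0; have := h e%:C; rewrite ltcR => /(_ e0).
  by apply: filterS => t; rewrite rnorm_lt.
move=> h; apply/cvgrPdist_lt => e e0.
have -> : e = (complex.Re e)%:C.
  by move: e0; rewrite ltcE /=; case: e => a b /= /andP[/eqP ->].
have /h : 0 < complex.Re e by move: e0; rewrite ltcE => /andP[].
by apply: filterS => t; rewrite rnorm_lt.
Qed.

Lemma near_realP (x : R) (P : R -> Prop) :
  (\forall t \near x, P t) <->
  exists2 d : R, 0 < d & forall t, `|x - t| < d -> P t.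
Proof.
split.
  by move=> /nbhs_ballP[d /= d0 h]; exists d => // t xt; apply: h.
by move=> [d d0 h]; apply/nbhs_ballP; exists d => //= t; apply: h.
Qed.

Lemma continuous_rnorm (V : normedModType R[i]) : continuous (@rnorm V).
Proof.
move=> x; apply/cvgrPdist_lt => e e0.
have : (id : V -> V) @ x --> x by exact: cvg_id.
move=> /cvg_rnorm/(_ e e0); apply: filterS => t /=.
apply: le_lt_trans; rewrite ler_norml.
have := rdistD t x 0; have := rdistD x t 0; rewrite !subr0 (rdistC t x).
by lra.
Qed.

End RealNorm.

(** * Matrix norms and limits, entry by entry *)

Section MatrixNorm.
Variables (R : realType) (m n : nat).
Implicit Type A : 'M[R[i]]_(m, n).

Lemma rnorm_mx_le A (e : R) :
  0 <= e -> (rnorm A <= e) <-> (forall i j, rnorm (A i j) <= e).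
Proof.
move=> e0; have eC0 : 0 <= e%:C by rewrite lecR.
rewrite -rnorm_le [`|A|]/Num.Def.normr /= mx_normE -[e%:C]/(NngNum eC0)%:num.
rewrite num_le; split.
  move=> /bigmax_leP[_ h] i j; rewrite -rnorm_le.
  by have := h (i, j) isT; rewrite -num_le.
move=> h; apply/bigmax_leP; split => [|[i j] _]; rewrite -num_le //=.
by rewrite rnorm_le.
Qed.

Lemma rnorm_entry A i j : rnorm (A i j) <= rnorm A.
Proof. exact: (proj1 (rnorm_mx_le A (rnorm_ge0 A)) (lexx _) i j). Qed.

Lemma rnorm_mx_lt A (e : R) :
  0 < e -> (rnorm A < e) <-> (forall i j, rnorm (A i j) < e).
Proof.
move=> e0; split=> [Ae i j|h]; first exact: le_lt_trans (rnorm_entry _ _ _) Ae.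
rewrite ltNge; apply/negP => eA.
pose s := \big[Num.max/0]_(k : 'I_m * 'I_n) rnorm (A k.1 k.2).
have s0 : 0 <= s by apply: bigmax_ge_id.
have : rnorm A <= s.
  by apply/rnorm_mx_le => // i j; apply: (le_bigmax _ _ (i, j)).
apply/negP; rewrite -ltNge (lt_le_trans _ eA) //.
by apply/bigmax_ltP; split => // -[i j] _; apply: h.
Qed.

Lemma cvg_mxP {T : Type} {F : set_system T} {FF : Filter F}
    (f : T -> 'M[R[i]]_(m, n)) A :
  f @ F --> A <-> forall i j, (fun t => f t i j) @ F --> A i j.
Proof.
split.
  move=> /cvg_rnorm h i j; apply/cvg_rnorm => e e0.
  apply: filterS (h e e0) => t; apply: le_lt_trans.
  by have := rnorm_entry (A - f t) i j; rewrite !mxE.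
move=> h; apply/cvg_rnorm => e e0.
have : \forall t \near F, forall ij : 'I_m * 'I_n,
    rnorm (A ij.1 ij.2 - f t ij.1 ij.2) < e.
  apply: filter_forall => -[i j] /=.
  by have /cvg_rnorm := h i j; apply.
apply: filterS => t ht; apply/rnorm_mx_lt => // i j.
by have := ht (i, j); rewrite !mxE.
Qed.

End MatrixNorm.

(** * Limits along an arbitrary filter *)

Section ComplexLimits.
Variables (R : realType) (T : Type) (F : set_system T).
Context {FF : Filter F}.

Lemma cvg_const (V : normedModType R[i]) (a : V) : (fun=> a) @ F --> a.
Proof. exact: cvg_cst. Qed.

Lemma cvg_add (V : normedModType R[i]) (f g : T -> V) (a b : V) :
  f @ F --> a -> g @ F --> b -> (fun t => f t + g t) @ F --> a + b.
Proof. by move=> fa gb; exact (cvgD fa gb). Qed.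

Lemma cvg_sub (V : normedModType R[i]) (f g : T -> V) (a b : V) :
  f @ F --> a -> g @ F --> b -> (fun t => f t - g t) @ F --> a - b.
Proof. by move=> fa gb; exact (cvgB fa gb). Qed.

Lemma cvg_opp (V : normedModType R[i]) (f : T -> V) (a : V) :
  f @ F --> a -> (fun t => - f t) @ F --> - a.
Proof. by move=> fa; exact (cvgN fa). Qed.

Lemma cvg_mul (f g : T -> R[i]) (a b : R[i]) :
  f @ F --> a -> g @ F --> b -> (fun t => f t * g t) @ F --> a * b.
Proof. by move=> fa gb; exact (@cvgM R[i] T F FF f g a b fa gb). Qed.

Lemma cvg_sum_mul (I : Type) (r : seq I) (f g : I -> T -> R[i])
    (a b : I -> R[i]) :
  (forall i, f i @ F --> a i) -> (forall i, g i @ F --> b i) ->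
  (fun t => \sum_(i <- r) f i t * g i t) @ F --> \sum_(i <- r) a i * b i.
Proof.
move=> fa gb; elim: r => [|i r IH].
  rewrite big_nil; under eq_fun do rewrite big_nil.
  exact: cvg_cst.
rewrite big_cons; under eq_fun do rewrite big_cons.
exact (@cvg_add R[i] _ _ _ _ (cvg_mul (fa i) (gb i)) IH).
Qed.

Lemma cvg_mulmx (m n p : nat) (f : T -> 'M[R[i]]_(m, n))
    (g : T -> 'M[R[i]]_(n, p)) (A : 'M[R[i]]_(m, n)) (B : 'M[R[i]]_(n, p)) :
  f @ F --> A -> g @ F --> B -> (fun t => f t *m g t) @ F --> A *m B.
Proof.
move=> /cvg_mxP fA /cvg_mxP gB; apply/cvg_mxP => i j.
rewrite mxE; under eq_fun do rewrite mxE.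
by apply: cvg_sum_mul => k; [apply: fA|apply: gB].
Qed.

Lemma cvg_scale (V : normedModType R[i]) (f : T -> R[i]) (a : R[i]) (x : V) :
  f @ F --> a -> (fun t => f t *: x) @ F --> a *: x.
Proof.
move=> /cvg_rnorm fa; apply/cvg_rnorm => e e0.
have x0 : 0 < rnorm x + 1 by have := rnorm_ge0 x; lra.
apply: filterS (fa _ (divr_gt0 e0 x0)) => t ft.
rewrite -scalerBl rnormZ; move: ft; rewrite ltr_pdivlMr //.
by have := rnorm_ge0 (a - f t); nra.
Qed.

End ComplexLimits.
Arguments cvg_const {R T F FF V} a.

(** * The real line *)

Section RealLine.
Variable R : realType.

(** A supremum argument: the local hypothesis at the supremum [m] of the points reachable from [a]
    carries the chain across [m], which is absurd unless the chain has reached [b]. *)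
Lemma interval_induction (a b : R) (Q : R -> R -> Prop) :
  a <= b ->
  (forall x y z, a <= x <= y -> y <= z <= b -> Q x y -> Q y z -> Q x z) ->
  (forall t, a <= t <= b -> exists2 r, 0 < r &
     forall x y, a <= x <= t -> t <= y <= b -> t - r < x -> y < t + r -> Q x y) ->
  Q a b.
Proof.
move=> ab Qtrans Qloc.
pose S : set R := [set t | a <= t <= b /\ Q a t].
have Sa : S a.
  split; first by rewrite lexx.
  have [|r r0] := Qloc a; first by rewrite lexx.
  by apply; lra.
have Sub : ubound S b by move=> t [/andP[]].
have supS : has_sup S by split; [exists a|exists b].
set m := sup S.
have am : a <= m by apply: ub_le_sup => //; exists b.
have mb : m <= b by apply: ge_sup => //; exists a.
have [|r r0 rQ] := Qloc m; first by rewrite am.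
have [t [/andP[at_ tb] Qt] mt] := sup_adherent r0 supS.
have tm : t <= m by apply: ub_le_sup; [exists b|split => //; apply/andP].
pose y := Num.min (m + r / 2) b.
have ym : m <= y by rewrite le_min mb andbT; lra.
have yb : y <= b by rewrite ge_min lexx orbT.
have yr : y < m + r by rewrite gt_min; apply/orP; left; lra.
have Qy : Q a y.
  apply: (Qtrans _ t); rewrite ?lexx //; first by apply/andP; split; lra.
  by apply: rQ => //; rewrite ?at_ ?ym.
have Sy : S y by split => //; rewrite yb andbT (le_trans am).
have : y <= m by apply: ub_le_sup => //; exists b.
by move: Qy; rewrite /y; case: (leP (m + r / 2) b) => // _ _; lra.
Qed.

Lemma exists_notin (s : seq R) (a b : R) :
  a < b -> exists2 h, a < h < b & h \notin s.
Proof.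
elim: s a b => [|x s IH] a b ab; first by exists ((a + b) / 2) => //; lra.
have [xc|cx] := leP x ((a + b) / 2).
  have [|h hab hs] := IH ((a + b) / 2) b; first by lra.
  exists h; first by lra.
  by rewrite inE negb_or hs andbT; apply/eqP => hx; lra.
have [|h hab hs] := IH a ((a + b) / 2); first by lra.
exists h; first by lra.
by rewrite inE negb_or hs andbT; apply/eqP => hx; lra.
Qed.

Lemma rnorm_complex_le (a b : R) : rnorm (Complex a b) <= `|a| + `|b|.
Proof.
have -> : Complex a b = a%:C + 'i * b%:C by rewrite [LHS]complexE.
apply: le_trans (rnormD _ _) _; rewrite rnormM !rnormR.
suff -> : rnorm ('i : R[i]) = 1 by rewrite mul1r.
by rewrite /rnorm normc_def /= expr0n /= add0r expr1n sqrtr1.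
Qed.

Lemma continuous_real_complex : continuous (fun x : R => x%:C).
Proof.
move=> x; apply/cvg_rnorm => e e0; apply/near_realP; exists e => // t xt.
by rewrite -rmorphB /= rnormR.
Qed.

(* The parabola s + i c s (1 - s) meets a given point off the real axis for at
   most one value of c. *)
Lemma path_avoiding_roots (d : {poly R[i]}) : d.[0] != 0 -> d.[1] != 0 ->
  exists z : R -> R[i],
    [/\ continuous z, z 0 = 0, z 1 = 1 &
     forall s, 0 <= s <= 1 -> d.[z s] != 0 /\ rnorm (z s) <= 2].
Proof.
move=> d0 d1; have [r dr] := closed_field_poly_normal d.
have dn0 : d != 0 by apply: contraNneq d0 => ->; rewrite horner0.
pose bad := [seq complex.Im w / (complex.Re w * (1 - complex.Re w)) | w <- r].
have [c c01 cbad] := exists_notin bad ltr01.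
pose z (s : R) := Complex s (c * (s * (1 - s))).
exists z; split.
- have -> : z = fun s : R => s%:C + s%:C * (1 - s%:C) * ('i * c%:C).
    apply/funext => s; rewrite /z /=; apply/eqP; rewrite eq_complex /=.
    by apply/andP; split; apply/eqP; ring.
  move=> s; have cs := @continuous_real_complex s.
  exact (cvg_add cs (cvg_mul (cvg_mul cs (cvg_sub (cvg_const _) cs)) (cvg_const _))).
- by rewrite /z mul0r mulr0.
- by rewrite /z subrr !mulr0.
move=> s /andP[s0 s1]; split; last first.
  apply: le_trans (rnorm_complex_le _ _) _.
  rewrite !ger0_norm //; last by rewrite !mulr_ge0 // ?subr_ge0 //; lra.
  suff : c * (s * (1 - s)) <= 1 * (1 * 1) by lra.
  by rewrite !ler_pM // ?mulr_ge0 ?subr_ge0 //; lra.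
(* At both ends the quotients in [bad] lose their meaning, but there [z s] is 0 or 1, not a root by
   hypothesis. *)
have [->|sn0] := eqVneq s 0; first by rewrite /z mul0r mulr0.
have [->|sn1] := eqVneq s 1; first by rewrite /z subrr !mulr0.
apply: contra cbad; rewrite -/(root d (z s)) dr rootZ ?lead_coef_eq0 //.
rewrite root_prod_XsubC => zr; apply/mapP; exists (z s) => //=.
by rewrite mulfK // mulf_neq0 // subr_eq0 eq_sym.
Qed.

(** Pigeonhole: a path that strays further than [3 * n * e] from its start passes, by the
    intermediate value theorem, through [n + 1] distances spaced by [3 * e]. Two of these points lie
    in the same disc, hence less than [2 * e] apart. *)
Lemma trapped_path_dist (n : nat) (m : 'I_n -> R[i]) (e a b : R)
    (f : R -> R[i]) :
  continuous f -> (forall s, a <= s <= b -> exists j, rnorm (f s - m j) < e) ->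
  forall s, a <= s <= b -> rnorm (f s - f a) <= 3 * n%:R * e.
Proof.
move=> fc fm s /andP[as_ sb]; rewrite leNgt; apply/negP => big.
have e0 : 0 < e.
  by have [|j] := fm s; [rewrite as_|apply: le_lt_trans; apply: rnorm_ge0].
pose g t := rnorm (f t - f a).
have gc : continuous g.
  move=> t; apply: (continuous_comp (f := fun t => f t - f a)).
    by exact (cvg_sub (fc t) (cvg_const _)).
  exact: continuous_rnorm.
have ga : g a = 0 by rewrite /g subrr rnorm0.
pose v (k : 'I_n.+1) : R := 3 * k%:R * e.
have /choice[t ht] : forall k : 'I_n.+1, exists t, a <= t <= s /\ g t = v k.
  move=> k; have [||t] := @IVT R g a s (v k) as_.
  - exact: continuous_subspaceT.
  - rewrite ga; apply/andP; split.
      by rewrite ge_min /v !mulr_ge0 // ltW.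
    rewrite le_max; apply/orP; right; apply: le_trans (ltW big).
    by rewrite ler_pM2r // ler_pM2l // ler_nat -ltnS.
  - by rewrite in_itv /= => tas gt; exists t.
have /choice[j hj] : forall k, exists j, rnorm (f (t k) - m j) < e.
  by move=> k; apply: fm; have [/andP[-> /= /le_trans->]] := ht k.
suff /leq_card : injective j by rewrite !card_ord ltnn.
move=> k l jkl; have [_ gk] := ht k; have [_ gl] := ht l.
have jk := hj k; have jl := hj l; rewrite -jkl in jl.
have d1 : rnorm (f (t k) - f (t l)) < e + e.
  by apply: le_lt_trans (rdistD (m (j k)) _ _) _; rewrite ltrD // rdistC.
have dk := rdistD (f (t l)) (f (t k)) (f a).
have dl := rdistD (f (t k)) (f (t l)) (f a).
rewrite -/(g _) -/(g _) gk gl in dk; rewrite -/(g _) -/(g _) gk gl (rdistC (f (t l))) in dl.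
rewrite /v in dk dl.
have kl : (k%:R : R) < l%:R + 1 by rewrite -(ltr_pM2r e0); lra.
have lk : (l%:R : R) < k%:R + 1 by rewrite -(ltr_pM2r e0); lra.
by apply/val_inj/eqP; rewrite eqn_leq -ltnS -(ltnS l) -!(ltr_nat R) -!natr1 kl lk.
Qed.

End RealLine.

(** * Labelled spectra *)

Section Spectrum.
Variable R : realType.

(** An identity of polynomials replaces the list [spectrum], whose order is arbitrary, so that
    eigenvalues can be followed label by label. *)
Definition has_spec n (A : 'M[R[i]]_n) (x : 'I_n -> R[i]) : Prop :=
  char_poly A = \prod_j ('X - (x j)%:P).

Lemma has_spec_perm n (A : 'M[R[i]]_n) x (s : 'S_n) :
  has_spec A x -> has_spec A (x \o s).
Proof. by rewrite /has_spec => ->; rewrite (reindex_inj (@perm_inj _ s)). Qed.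

Lemma has_spec_spectrum n (A : 'M[R[i]]_n) x :
  has_spec A x <-> perm_eq (spectrum A) [seq x j | j <- enum 'I_n].
Proof.
have prodE : \prod_j ('X - (x j)%:P) =
    \prod_(z <- [seq x j | j <- enum 'I_n]) ('X - z%:P).
  by rewrite big_map big_enum.
split=> [Ax|Ax]; last first.
  by rewrite /has_spec char_poly_spectrum prodE; apply: perm_big.
by apply: prod_XsubC_eq; rewrite -char_poly_spectrum Ax prodE.
Qed.

Lemma has_spec_unique n (A : 'M[R[i]]_n) x y :
  has_spec A x -> has_spec A y -> exists s : 'S_n, forall j, x j = y (s j).
Proof.
move=> /has_spec_spectrum Ax /has_spec_spectrum Ay.
have /tuple_permP[s xs] : perm_eq [seq x j | j <- enum 'I_n]
    [tuple y j | j < n] by rewrite /= -(permPl Ax) (permPl Ay).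
exists s => j; have := congr1 (fun r => nth 0 r j) xs.
rewrite /= !(nth_map j) -?enumT ?size_enum_ord // !nth_ord_enum.
by rewrite tnth_mktuple.
Qed.

Lemma has_spec_exists n (A : 'M[R[i]]_n) : exists x, has_spec A x.
Proof.
exists (fun j => (spectrum A)`_j); apply/has_spec_spectrum.
rewrite (_ : [seq _ | _ <- _] = spectrum A) //.
rewrite (map_comp (nth 0 (spectrum A)) val) val_enum_ord.
by rewrite -[X in iota 0 X](size_spectrum A) map_nth_iota0 // take_size.
Qed.

Lemma horner_has_spec n (A : 'M[R[i]]_n) x z :
  has_spec A x -> (char_poly A).[z] = \prod_j (z - x j).
Proof.
by move=> ->; rewrite horner_prod; apply: eq_bigr => j _; rewrite !hornerE.
Qed.

Lemma root_has_spec n (A : 'M[R[i]]_n) x z :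
  has_spec A x -> root (char_poly A) z -> exists j, z = x j.
Proof.
move=> Ax; rewrite rootE (horner_has_spec z Ax) => /prodf_eq0[j _].
by rewrite subr_eq0 => /eqP ->; exists j.
Qed.

Lemma has_spec_root n (A : 'M[R[i]]_n) x j :
  has_spec A x -> root (char_poly A) (x j).
Proof.
move=> Ax; rewrite rootE (horner_has_spec _ Ax).
by apply/prodf_eq0; exists j => //; rewrite subrr.
Qed.

Lemma has_spec_of_roots n (A : 'M[R[i]]_n) x :
  injective x -> (forall j, root (char_poly A) (x j)) -> has_spec A x.
Proof.
move=> xinj xroot.
have := @all_roots_prod_XsubC _ (char_poly A) [seq x j | j <- enum 'I_n].
rewrite (monicP (char_poly_monic A)) scale1r big_map big_enum; apply.
- by rewrite size_char_poly size_map size_enum_ord.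
- by apply/allP => _ /mapP[j _ ->].
- by rewrite uniq_rootsE map_inj_uniq // enum_uniq.
Qed.

Lemma separable_char_poly n (A : 'M[R[i]]_n) x :
  has_spec A x -> separable_poly (char_poly A) <-> injective x.
Proof.
move=> Ax; have -> : char_poly A =
    \prod_(z <- [seq x j | j <- enum 'I_n]) ('X - z%:P).
  by rewrite Ax big_map big_enum.
by rewrite separable_prod_XsubC; split=> /injectiveP.
Qed.

Lemma char_poly_conj n (P A : 'M[R[i]]_n) :
  P \in unitmx -> char_poly (invmx P *m A *m P) = char_poly A.
Proof.
move=> Pu; pose Q := map_mx polyC P.
have Qu : Q \in unitmx by rewrite map_unitmx.
rewrite /char_poly; have -> : char_poly_mx (invmx P *m A *m P) =
    invmx Q *m char_poly_mx A *m Q.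
  rewrite /char_poly_mx mulmxBr mulmxBl !map_mxM map_invmx.
  by rewrite scalar_mxC mulmxKV.
rewrite !det_mulmx mulrAC -det_mulmx.
by rewrite mulVmx // det1 mul1r.
Qed.

(** The polynomial is the resultant of the characteristic polynomial and its derivative over the
    ring of polynomials in the line parameter. Evaluation at [z] commutes with it because the
    leading coefficients 1 and [n.+1] are nonzero constants. *)
Lemma discriminant_line n (X Y : 'M[R[i]]_n.+1) :
  exists d : {poly R[i]}, forall z,
    (d.[z] != 0) = separable_poly (char_poly (X + z *: (Y - X))).
Proof.
pose M := map_mx polyC X + 'X *: map_mx polyC (Y - X).
pose chi := char_poly M.
exists (resultant chi chi^`()) => z.
pose ev : {rmorphism {poly R[i]} -> R[i]} := horner_eval z.
have evM : map_poly ev chi = char_poly (X + z *: (Y - X)).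
  rewrite map_char_poly; congr char_poly; apply/matrixP => i j.
  by rewrite !mxE /= /horner_eval !hornerE.
have mchi : chi \is monic by apply: char_poly_monic.
have lchi : lead_coef chi^`() = n.+1%:R.
  have cn : (chi^`())`_n = n.+1%:R.
    have := monicP mchi; rewrite lead_coefE size_char_poly coef_deriv => ->.
    by [].
  have /eqP sz : size chi^`() == n.+1.
    rewrite eqn_leq -ltnS -(size_char_poly M) lt_size_deriv ?monic_neq0 //=.
    rewrite ltnNge; apply/negP => /leq_sizeP/(_ n (leqnn n)).
    by rewrite cn => /eqP; rewrite -polyC_natr polyC_eq0 pnatr_eq0.
  by rewrite lead_coefE sz.
rewrite -[_.[z]]/(ev _) map_resultant ?(monicP mchi) ?rmorph1 ?oner_neq0 //.
  rewrite -deriv_map evM resultant_eq0 -leqNgt separable_poly.unlock /coprimep.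
  rewrite eqn_leq size_poly_gt0 gcdp_eq0 negb_and.
  by rewrite monic_neq0 ?char_poly_monic //= andbT.
by rewrite lchi rmorph_nat pnatr_eq0.
Qed.

End Spectrum.

(** * Perturbation of eigenvalues *)

Section Perturbation.
Variable R : realType.

(** The factors are exchanged one at a time; [1 <= c] lets the bounds of the shorter products be
    absorbed into the last power. *)
Lemma prod_lipschitz (I : Type) (r : seq I) (a b : I -> R[i]) (c d : R) :
  1 <= c -> 0 <= d -> (forall i, rnorm (a i) <= c) ->
  (forall i, rnorm (b i) <= c) -> (forall i, rnorm (a i - b i) <= d) ->
  rnorm (\prod_(i <- r) a i - \prod_(i <- r) b i) <=
    (size r)%:R * c ^+ size r * d.
Proof.
move=> c1 d0 ac bc abd; have c0 : 0 <= c := le_trans ler01 c1.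
elim: r => [|i r IH]; first by rewrite !big_nil subrr rnorm0 !mul0r.
rewrite !big_cons /=; set A := \prod_(j <- r) a j in IH *.
set B := \prod_(j <- r) b j in IH *.
have Ac : rnorm A <= c ^+ size r.
  have -> : c ^+ size r = \prod_(j <- r) c.
    by rewrite big_const_seq count_predT iter_mulr_1.
  by rewrite rnorm_prod; apply: ler_prod => j _; rewrite rnorm_ge0 ac.
have -> : a i * A - b i * B = (a i - b i) * A + b i * (A - B) by ring.
apply: le_trans (rnormD _ _) _; rewrite !rnormM.
have h1 : rnorm (a i - b i) * rnorm A <= d * c ^+ size r.
  by apply: ler_pM => //; apply: rnorm_ge0.
have h2 : rnorm (b i) * rnorm (A - B) <= c * ((size r)%:R * c ^+ size r * d).
  by apply: ler_pM => //; apply: rnorm_ge0.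
apply: le_trans (lerD h1 h2) _.
have h3 : d * c ^+ size r <= c * (d * c ^+ size r).
  by rewrite ler_peMl // mulr_ge0 // exprn_ge0.
rewrite exprS -natr1; apply: le_trans (lerD h3 (lexx _)) _.
by rewrite le_eqVlt; apply/orP; left; apply/eqP; ring.
Qed.

Lemma det_lipschitz n (c : R) : exists2 L : R, 0 < L &
  forall A B : 'M[R[i]]_n, rnorm A <= c -> rnorm B <= c ->
    rnorm (\det A - \det B) <= L * rnorm (A - B).
Proof.
(* The maximum with 1 serves [prod_lipschitz]; the final 1 in [L] keeps it positive when [n] is
   0. *)
pose c' := Num.max c 1; pose l := n%:R * c' ^+ n; pose L := #|'S_n|%:R * l + 1.
have c1 : 1 <= c' by rewrite le_max lexx orbT.
have l0 : 0 <= l by rewrite mulr_ge0 // exprn_ge0 // (le_trans ler01).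
exists L => [|A B Ac Bc]; first by rewrite /L ltr_wpDl // mulr_ge0.
have Ac' i j : rnorm (A i j) <= c'.
  by rewrite (le_trans (rnorm_entry _ _ _)) // (le_trans Ac) // le_max lexx.
have Bc' i j : rnorm (B i j) <= c'.
  by rewrite (le_trans (rnorm_entry _ _ _)) // (le_trans Bc) // le_max lexx.
have AB i j : rnorm (A i j - B i j) <= rnorm (A - B).
  by have := rnorm_entry (A - B) i j; rewrite !mxE.
rewrite /determinant -sumrB; apply: le_trans (rnorm_sum _ _ _) _.
apply: (@le_trans _ _ (\sum_(s : 'S_n) l * rnorm (A - B))).
  apply: ler_sum => s _; rewrite -mulrBr rnormM.
  have -> : rnorm ((-1) ^+ s : R[i]) = 1.
    by case: (odd_perm s); rewrite ?expr0 ?expr1 ?rnormN -[1]/(1%:C) rnormR normr1.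
  have := @prod_lipschitz _ (enum 'I_n) (fun i => A i (s i))
    (fun i => B i (s i)) c' _ c1 (rnorm_ge0 (A - B)).
  by rewrite !big_enum size_enum_ord mul1r; apply.
by rewrite sumr_const -mulr_natl mulrA /L mulrDl lerDl mul1r rnorm_ge0.
Qed.

Lemma rnorm_mulmx m n p (A : 'M[R[i]]_(m, n)) (B : 'M[R[i]]_(n, p)) :
  rnorm (A *m B) <= n%:R * (rnorm A * rnorm B).
Proof.
apply/rnorm_mx_le => [|i j]; first by rewrite !mulr_ge0 ?rnorm_ge0.
rewrite mxE; apply: le_trans (rnorm_sum _ _ _) _.
rewrite -[n in n%:R]card_ord mulr_natl -sumr_const; apply: ler_sum => k _.
by rewrite rnormM ler_pM ?rnorm_ge0 ?rnorm_entry.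
Qed.

Lemma char_root_le n (B : 'M[R[i]]_n) b :
  root (char_poly B) b -> rnorm b <= n%:R * rnorm B.
Proof.
rewrite -eigenvalue_root_char => /eigenvalueP[v vB v0].
have v_gt0 : 0 < rnorm v by rewrite lt_neqAle rnorm_ge0 eq_sym rnorm_eq0 v0.
rewrite -(ler_pM2r v_gt0) -rnormZ -vB; apply: le_trans (rnorm_mulmx _ _) _.
by rewrite mulrCA mulrA [rnorm v * _]mulrC mulrAC.
Qed.

Lemma horner_char_polyE n (A : 'M[R[i]]_n) z :
  (char_poly A).[z] = \det (z%:M - A).
Proof.
rewrite -[_.[z]]/(horner_eval z _) /char_poly -det_map_mx; congr (\det _).
by apply/matrixP => i j; rewrite !mxE /= /horner_eval hornerD hornerN hornerMn hornerX hornerC.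
Qed.

Lemma small_factor n (f : 'I_n -> R[i]) (e : R) : 0 < e ->
  rnorm (\prod_j f j) < e ^+ n -> exists j, rnorm (f j) < e.
Proof.
move=> e0 fe; apply: contrapT => h.
suff : e ^+ n <= rnorm (\prod_j f j) by rewrite leNgt fe.
rewrite rnorm_prod -[n in e ^+ n]card_ord -prodr_const.
apply: ler_prod => j _; rewrite ltW //= leNgt; apply/negP => fj.
by apply: h; exists j.
Qed.

(** The product of the [b - x j] is [\det (b%:M - A)], while [\det (b%:M - B)] vanishes; so the
    product is small and so is one factor. Uniformity in [A] allows the comparison matrix to vary
    along a path. *)
Lemma char_roots_near n (K e : R) : 0 < e -> exists2 d : R, 0 < d &
  forall (A B : 'M[R[i]]_n) x b, rnorm A <= K -> rnorm (A - B) < d ->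
    has_spec A x -> root (char_poly B) b -> exists j, rnorm (b - x j) < e.
Proof.
(* [B] has norm at most [|K| + 1], so its eigenvalue [b] is at most [n] times that; [c] then bounds
   both [b%:M - A] and [b%:M - B]. *)
move=> e0; pose c := n%:R * (`|K| + 1) + (`|K| + 1).
have [L L0 detL] := det_lipschitz n c.
have en0 : 0 < e ^+ n by apply: exprn_gt0.
exists (Num.min 1 (e ^+ n / L)).
  by rewrite lt_min ltr01 divr_gt0.
move=> A B x b AK; rewrite lt_min => /andP[AB1 ABe] Ax bB.
have AK' : rnorm A <= `|K| + 1 by have := ler_norm K; lra.
have BK : rnorm B <= `|K| + 1.
  by have := rdistD A B 0; rewrite !subr0 rdistC; have := ler_norm K; lra.
have zc (D : 'M[R[i]]_n) : rnorm D <= `|K| + 1 -> rnorm (b%:M - D) <= c.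
  move=> DK; apply: le_trans (rnormD _ _) _; rewrite rnormN; apply: lerD => //.
  have bK : rnorm b <= n%:R * (`|K| + 1).
    by apply: le_trans (char_root_le bB) _; rewrite ler_wpM2l.
  apply/rnorm_mx_le => [|i j]; first by rewrite (le_trans _ bK) // rnorm_ge0.
  by rewrite mxE; case: (i == j); rewrite ?mulr1n // mulr0n rnorm0 (le_trans _ bK) ?rnorm_ge0.
apply: small_factor => //; rewrite -(horner_has_spec _ Ax) horner_char_polyE.
have := detL _ _ (zc _ AK') (zc _ BK).
rewrite -[\det (b%:M - B)]horner_char_polyE (rootP bB) subr0.
move=> /le_lt_trans; apply.
rewrite opprB addrC addrA subrK rdistC.
by rewrite mulrC -ltr_pdivlMr.
Qed.

(** The opposite direction: an eigenvalue [a] of [A] persists, since [\det (a%:M - B)] is close to 0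
    and is the product of the distances, up to phase, from [a] to the eigenvalues of [B]. *)
Lemma near_char_root n (A : 'M[R[i]]_n) a (e : R) :
  0 < e -> root (char_poly A) a -> exists2 d : R, 0 < d &
    forall B, rnorm (A - B) < d ->
      exists2 b, root (char_poly B) b & rnorm (a - b) < e.
Proof.
move=> e0 aA; pose D (B : 'M[R[i]]_n) := a%:M - B.
have [L L0 detL] := det_lipschitz n (rnorm (D A) + 1).
have en0 : 0 < e ^+ n by apply: exprn_gt0.
exists (Num.min 1 (e ^+ n / L)).
  by rewrite lt_min ltr01 divr_gt0.
move=> B; rewrite lt_min => /andP[AB1 ABe].
have DAB : D A - D B = B - A by rewrite /D opprB addrC addrA subrK.
have DB : rnorm (D B) <= rnorm (D A) + 1.
  by have := rdistD (D A) (D B) 0; rewrite !subr0 (rdistC (D B) (D A)) DAB (rdistC B); lra.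
have [x Bx] := has_spec_exists B.
suff [j aj] : exists j, rnorm (a - x j) < e.
  by exists (x j) => //; apply: has_spec_root.
apply: small_factor => //; rewrite -(horner_has_spec _ Bx) horner_char_polyE.
have := detL (D A) (D B); rewrite -[\det (D A)]horner_char_polyE (rootP aA).
rewrite sub0r rnormN DAB (rdistC B) => /(_ _ DB) h.
apply: le_lt_trans (h _) _; first by rewrite lerDl.
by rewrite mulrC -ltr_pdivlMr.
Qed.

End Perturbation.

(** * Eigenpaths along a path with simple spectrum *)

Section Eigenpaths.
Variable R : realType.

Lemma finite_pos_lb (I : finType) (f : I -> R) :
  (forall i, 0 < f i) -> exists2 r, 0 < r & forall i, r <= f i.
Proof.
move=> f0; exists (\big[Num.min/1]_i f i); last by move=> i; apply: bigmin_le.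
by apply/bigmin_gtP.
Qed.

Lemma separation n (m : 'I_n -> R[i]) : injective m ->
  exists2 r : R, 0 < r & forall j k, rnorm (m j - m k) < r -> j = k.
Proof.
move=> minj; pose f (jk : 'I_n * 'I_n) : R :=
  if jk.1 == jk.2 then 1 else rnorm (m jk.1 - m jk.2).
have [[j k]|r r0 rf] := @finite_pos_lb _ f.
  rewrite /f /=; case: eqP => // jk.
  by rewrite lt_neqAle rnorm_ge0 eq_sym rnorm_eq0 subr_eq0 (inj_eq minj) andbT; apply/eqP.
exists r => // j k; have := rf (j, k); rewrite /f /=; case: eqP => // _.
by move=> /le_lt_trans h /h; rewrite ltxx.
Qed.

(** The retraction of the line onto an interval. Composing with it extends a path beyond the
    interval, which reduces continuity within the interval to plain continuity. *)
Definition clamp (a b s : R) : R := Num.max a (Num.min s b).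

Lemma clamp_itv a b s : a <= b -> a <= clamp a b s <= b.
Proof. by move=> ab; rewrite /clamp le_max lexx /= ge_max ab ge_min lexx orbT. Qed.

Lemma clamp_id a b s : a <= s <= b -> clamp a b s = s.
Proof. by move=> /andP[as_ sb]; rewrite /clamp min_l // max_r. Qed.

Lemma continuous_nonexpansive (f : R -> R) :
  (forall s t, s <= t -> f s <= f t <= f s + (t - s)) -> continuous f.
Proof.
move=> fl s; apply/cvgrPdist_lt => e e0; apply/near_realP.
exists e => // t; apply: le_lt_trans.
wlog st : s t / s <= t.
  by move=> h; have [/h//|/ltW/h] := leP s t; rewrite distrC (distrC t).
have /andP[f1 f2] := fl s t st.
by rewrite distrC (distrC s) !ger0_norm ?subr_ge0 //; lra.
Qed.

Lemma continuous_minr (b : R) : continuous (fun s : R => Num.min s b).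
Proof.
apply: continuous_nonexpansive => s t st.
by case: (leP s b); case: (leP t b); lra.
Qed.

Lemma continuous_maxr (b : R) : continuous (fun s : R => Num.max s b).
Proof.
apply: continuous_nonexpansive => s t st.
by case: (leP s b); case: (leP t b); lra.
Qed.

Lemma continuous_clamp a b : continuous (clamp a b).
Proof.
move=> s; rewrite /clamp; under eq_fun do rewrite maxC.
apply: (@continuous_comp _ _ _ (fun s => Num.min s b) (fun s => Num.max s a)).
  exact: continuous_minr.
exact: continuous_maxr.
Qed.

(** Concatenation at [b] without a case distinction, so that continuity is that of a sum. *)
Definition splice (V : zmodType) (b : R) (f g : R -> V) (s : R) : V :=
  f (Num.min s b) + (g (Num.max s b) - g b).

Lemma spliceL (V : zmodType) b (f g : R -> V) s : s <= b -> splice b f g s = f s.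
Proof. by move=> sb; rewrite /splice min_l // max_r // subrr addr0. Qed.

Lemma spliceR (V : zmodType) b (f g : R -> V) s :
  f b = g b -> b <= s -> splice b f g s = g s.
Proof. by move=> fg bs; rewrite /splice min_r // max_l // fg addrC subrK. Qed.

Lemma continuous_splice (V : normedModType R[i]) b (f g : R -> V) :
  continuous f -> continuous g -> continuous (splice b f g).
Proof.
move=> fc gc s.
have fm := @continuous_comp _ _ _ _ f s (@continuous_minr b s) (@fc _).
have gm := @continuous_comp _ _ _ _ g s (@continuous_maxr b s) (@gc _).
exact (cvg_add fm (cvg_sub gm (cvg_const (g b)))).
Qed.

Lemma continuous_nearP (V : normedModType R[i]) (f : R -> V) t e :
  {for t, continuous f} -> 0 < e ->
  exists2 d : R, 0 < d & forall s, `|t - s| < d -> rnorm (f t - f s) < e.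
Proof. by move=> /cvg_rnorm fc /fc /near_realP. Qed.

(** Discs around the simple eigenvalues of [P t], of half their separation as radius, contain one
    eigenvalue of [P s] each when [s] is near [t]. Choosing that one labels the spectrum, and
    uniqueness in the disc makes the choice continuous. *)
Lemma local_eigenpaths n (P : R -> 'M[R[i]]_n) t : continuous P ->
  separable_poly (char_poly (P t)) ->
  exists2 r : R, 0 < r & exists p : 'I_n -> R -> R[i],
    forall s, `|t - s| < r ->
      has_spec (P s) (p^~ s) /\ forall j, {for s, continuous (p j)}.
Proof.
move=> Pc; have [m Pm] := has_spec_exists (P t).
move=> /(separable_char_poly Pm) minj.
have [rho2 rho20 msep] := separation minj; pose rho := rho2 / 2.
have rho0 : 0 < rho by rewrite divr_gt0.
have /choice[d hd] : forall j, exists d : R, 0 < d /\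
    forall B, rnorm (P t - B) < d ->
      exists2 b, root (char_poly B) b & rnorm (m j - b) < rho.
  move=> j; have [d d0 hd] := near_char_root rho0 (has_spec_root j Pm).
  by exists d.
have [d' d'0 d'd] := finite_pos_lb (fun j => (hd j).1).
have [r r0 hr] := continuous_nearP (@Pc t) d'0.
exists r => //.
have /choice[p hp] : forall sj : R * 'I_n, exists b, `|t - sj.1| < r ->
    root (char_poly (P sj.1)) b /\ rnorm (m sj.2 - b) < rho.
  move=> [s j] /=; have [tsr|] := ltP `|t - s| r; last by exists 0.
  have [|b Pb mb] := (hd j).2 (P s); last by exists b.
  exact: lt_le_trans (hr _ tsr) (d'd _).
have pspec s : `|t - s| < r -> has_spec (P s) (fun j => p (s, j)).
  move=> tsr; apply: has_spec_of_roots => [j k pjk|j]; last first.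
    by have [] := hp (s, j) tsr.
  have [_ hj] := hp (s, j) tsr; have [_ hk] := hp (s, k) tsr.
  apply: msep; apply: le_lt_trans (rdistD (p (s, j)) _ _) _.
  by rewrite [rho2]splitr ltrD // pjk rdistC.
have puniq s j b : `|t - s| < r -> root (char_poly (P s)) b ->
    rnorm (m j - b) < rho -> b = p (s, j).
  move=> tsr Pb mb; have [k bk] := root_has_spec (pspec s tsr) Pb.
  rewrite bk in mb *; congr (p (s, _)); apply/esym/msep.
  have [_ hk] := hp (s, k) tsr.
  apply: le_lt_trans (rdistD (p (s, k)) _ _) _.
  by rewrite [rho2]splitr ltrD // rdistC.
exists (fun j s => p (s, j)) => s tsr; split; first exact: pspec.
move=> j; apply/cvg_rnorm => e e0; apply/near_realP.
have [Ppsj mpsj] := hp (s, j) tsr.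
(* The second bound keeps the eigenvalue of [P s'] found near [p (s, j)] inside the disc of [m j],
   where it must be the chosen one. *)
pose e' := Num.min e (rho - rnorm (m j - p (s, j))).
have e'0 : 0 < e' by rewrite lt_min e0 subr_gt0.
have [d1 d10 hd1] := near_char_root e'0 Ppsj.
have [r1 r10 hr1] := continuous_nearP (@Pc s) d10.
exists (Num.min r1 (r - `|t - s|)); first by rewrite lt_min r10 subr_gt0.
move=> s'; rewrite lt_min => /andP[ss' ss'r].
have [b Pb] := hd1 _ (hr1 _ ss'); rewrite lt_min => /andP[be bm].
suff <- : b = p (s', j) by [].
apply: puniq => //; last first.
  by apply: le_lt_trans (rdistD (p (s, j)) _ _) _; rewrite addrC -ltrBrDr.
by apply: le_lt_trans (ler_distD s _ _) _; rewrite addrC -ltrBrDr.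
Qed.

Lemma eigenpaths_exist n (P : R -> 'M[R[i]]_n) a b x : a <= b ->
  continuous P ->
  (forall s, a <= s <= b -> separable_poly (char_poly (P s))) ->
  has_spec (P a) x -> exists p : 'I_n -> R -> R[i],
    [/\ forall j, continuous (p j), forall j, p j a = x j &
        forall s, a <= s <= b -> has_spec (P s) (p^~ s)].
Proof.
move=> ab Pc Psep; move: x.
(* Quantifying over every labelling at [u] makes [Q] transitive: the second family starts from the
   labels where the first one ends. *)
pose Q u v := forall x, has_spec (P u) x -> exists p : 'I_n -> R -> R[i],
    [/\ forall j, continuous (p j), forall j, p j u = x j &
        forall s, u <= s <= v -> has_spec (P s) (p^~ s)].
apply: (@interval_induction R a b Q ab) => [u v w|t tab].
  move=> /andP[au uv] /andP[vw wb] Quv Qvw x Px.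
  have [p [pc px pP]] := Quv x Px.
  have [|q [qc qp qP]] := Qvw (p^~ v); first by apply: pP; rewrite uv lexx.
  exists (fun j => splice v (p j) (q j)); split.
  - by move=> j; apply: continuous_splice.
  - by move=> j; rewrite spliceL.
  move=> s /andP[us sw]; have [sv|vs] := leP s v.
    rewrite (_ : (fun j => _) = p^~ s); first by apply: pP; rewrite us.
    by apply/funext => j; rewrite spliceL.
  rewrite (_ : (fun j => _) = q^~ s); first by apply: qP; rewrite (ltW vs).
  by apply/funext => j; rewrite spliceR // ltW.
have [r r0 [p hp]] := local_eigenpaths Pc (Psep t tab).
exists r => // u v /andP[au ut] /andP[tv vb] tru vtr x Px.
have uv := le_trans ut tv.
have itv s : u <= s <= v -> `|t - s| < r.
  by move=> /andP[us sv]; rewrite ltr_norml; apply/andP; split; lra.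
have ur : `|t - u| < r by apply: itv; rewrite lexx.
have [s xs] := has_spec_unique Px (hp _ ur).1.
(* The permutation [s] fits the local branches to the prescribed labels, and the clamp makes them
   continuous on the whole line. *)
exists (fun j w => p (s j) (clamp u v w)); split.
- move=> j w; apply: (@continuous_comp _ _ _ (clamp u v) (p (s j))).
    exact: continuous_clamp.
  by have [_] := hp _ (itv _ (clamp_itv w uv)); apply.
- by move=> j; rewrite clamp_id ?lexx // xs.
move=> w uwv; rewrite clamp_id //; apply: (@has_spec_perm _ _ _ (p^~ w) s).
by have [] := hp _ (itv _ uwv).
Qed.

(** The label followed by [f] is locally constant: at [t] the branches are separated by [rho3], and
    near [t] neither [f] nor any branch moves by half of that. *)
Lemma selection_unique n (p : 'I_n -> R -> R[i]) (f : R -> R[i]) a b k :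
  a <= b -> continuous f -> (forall j, continuous (p j)) ->
  (forall s, a <= s <= b -> injective (p^~ s)) ->
  (forall s, a <= s <= b -> exists j, f s = p j s) ->
  f a = p k a -> f b = p k b.
Proof.
move=> ab fc pc pinj fp; move: k.
apply: (@interval_induction R a b
  (fun u v => forall k, f u = p k u -> f v = p k v) ab) => [u v w|t tab].
  by move=> _ _ Quv Qvw k /Quv /Qvw.
have [rho3 rho30 psep] := separation (pinj t tab); pose rho := rho3 / 2.
have rho0 : 0 < rho by rewrite divr_gt0.
have /choice[d hd] : forall j, exists d : R, 0 < d /\
    forall s, `|t - s| < d -> rnorm (p j t - p j s) < rho.
  move=> j; have [d d0 hd] := continuous_nearP (@pc j t) rho0.
  by exists d.
have [d' d'0 d'd] := finite_pos_lb (fun j => (hd j).1).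
have [r r0 hr] := continuous_nearP (@fc t) rho0.
have [k0 ftk] := fp t tab.
have key s : a <= s <= b -> `|t - s| < Num.min r d' ->
    f s = p k0 s /\ forall l, f s = p l s -> l = k0.
  move=> sab; rewrite lt_min => /andP[sr sd].
  have h l : f s = p l s -> l = k0.
    move=> fsl; apply: psep; apply: le_lt_trans (rdistD (p l s) _ _) _.
    rewrite [rho3]splitr ltrD //.
      by apply: (hd l).2; apply: lt_le_trans sd (d'd l).
    by rewrite -fsl -ftk rdistC; apply: hr.
  by have [l fsl] := fp s sab; split => //; rewrite -(h l fsl).
exists (Num.min r d'); first by rewrite lt_min r0.
move=> u v /andP[au ut] /andP[tv vb] tru vtr k.
have [||_ hu] := key u; first by apply/andP; split; lra.
  by rewrite ltr_norml; apply/andP; split; lra.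
have [||hv _] := key v; first by apply/andP; split; lra.
  by rewrite ltr_norml; apply/andP; split; lra.
by move=> /hu ->.
Qed.

End Eigenpaths.

(** * Paths of distinct labels and the symmetric section *)

Section LabelPath.
Variable R : realType.

Lemma exists_nonroot (d : {poly R[i]}) (a b : R) : d != 0 -> a < b ->
  exists2 h : R, a < h < b & d.[h%:C] != 0.
Proof.
move=> d0 ab; have [r dr] := closed_field_poly_normal d.
have [h hab hr] := exists_notin [seq complex.Re w | w <- r] ab.
exists h => //; apply: contra hr; rewrite -/(root d _) dr rootZ ?lead_coef_eq0 //.
by rewrite root_prod_XsubC => hr; apply/mapP; exists h%:C.
Qed.

(* The values of this product vanish exactly where two of the points on the
   complex lines through x j and y j collide. *)
Definition collision n (x y : 'I_n -> R[i]) : {poly R[i]} :=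
  \prod_(jk : 'I_n * 'I_n | jk.1 != jk.2)
    ((x jk.1 - x jk.2)%:P + 'X * (y jk.1 - y jk.2 - (x jk.1 - x jk.2))%:P).

Lemma collisionP n (x y : 'I_n -> R[i]) z :
  (collision x y).[z] != 0 <-> injective (fun j => x j + z * (y j - x j)).
Proof.
have fE (jk : 'I_n * 'I_n) :
    ((x jk.1 - x jk.2)%:P + 'X * (y jk.1 - y jk.2 - (x jk.1 - x jk.2))%:P).[z]
    = (x jk.1 + z * (y jk.1 - x jk.1)) - (x jk.2 + z * (y jk.2 - x jk.2)).
  by rewrite !hornerE; ring.
rewrite /collision horner_prod; split=> [/prodf_neq0 h j k jk|inj].
  apply/eqP; apply: contraT => njk; have := h (j, k) njk.
  by rewrite fE /= jk subrr eqxx.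
apply/prodf_neq0 => jk njk; rewrite fE subr_eq0.
by apply: contra njk => /eqP/inj ->.
Qed.

(** Linear interpolation with a complex parameter that avoids the collisions; the factor 2 is the
    bound on the parameter. *)
Lemma label_path n (x y : 'I_n -> R[i]) : injective x -> injective y ->
  exists q : 'I_n -> R -> R[i],
    [/\ forall j, continuous (q j), forall j, q j 0 = x j,
        forall j, q j 1 = y j & forall s, 0 <= s <= 1 ->
        injective (q^~ s) /\
        forall j, rnorm (q j s - x j) <= 2 * rnorm (y j - x j)].
Proof.
move=> xinj yinj.
have [||z [zc z0 z1 zs]] := @path_avoiding_roots R (collision x y).
- by apply/collisionP => j k; rewrite !mul0r !addr0 => /xinj.
- by apply/collisionP => j k; rewrite !mul1r !(addrC (x _)) !subrK => /yinj.
exists (fun j s => x j + z s * (y j - x j)); split.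
- move=> j s.
  exact (cvg_add (cvg_const (x j)) (cvg_mul (zc s) (cvg_const (y j - x j)))).
- by move=> j; rewrite z0 mul0r addr0.
- by move=> j; rewrite z1 mul1r addrC subrK.
move=> s /zs[/collisionP cs zs2]; split => // j.
by rewrite addrC addKr rnormM ler_wpM2r ?rnorm_ge0.
Qed.

(** Along the direction with coordinates 0, 1, 2, ... every difference of two labels is a
    nonconstant polynomial in [h], so only finitely many [h] make labels coincide. *)
Lemma near_injective n (m : 'I_n -> R[i]) (e : R) : 0 < e ->
  exists2 y : 'I_n -> R[i], injective y & forall j, rnorm (y j - m j) < e.
Proof.
move=> e0; pose w j := m j + (j : nat)%:R.
pose d := \prod_(jk : 'I_n * 'I_n | jk.1 != jk.2)
  ((m jk.1 - m jk.2)%:P + 'X * ((jk.1 : nat)%:R - (jk.2 : nat)%:R)%:P).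
have d0 : d != 0.
  apply/prodf_neq0 => -[j k] /= jk; apply: contra jk => /eqP h.
  have := congr1 (fun p : {poly R[i]} => p`_1) h.
  rewrite coefD coefC coefXM /= coefC add0r coef0 => /eqP.
  by rewrite subr_eq0 eqr_nat.
have e1 : 0 < e / n.+1%:R by rewrite divr_gt0.
have [h /andP[h0 he] dh] := exists_nonroot d0 e1.
exists (fun j => m j + h%:C * (j : nat)%:R) => [j k jk|j].
  apply/eqP; apply: contraT => njk; move: dh; rewrite horner_prod.
  move=> /prodf_neq0/(_ (j, k) njk); rewrite !hornerE /=.
  suff -> : m j - m k + h%:C * (j%:R - k%:R) = 0 by rewrite eqxx.
  by rewrite mulrBr addrACA -opprD jk subrr.
rewrite addrC addKr rnormM rnormR ger0_norm ?ltW //.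
have -> : rnorm ((j : nat)%:R : R[i]) = (j : nat)%:R.
  by rewrite -(rmorph_nat (real_complex R)) rnormR ger0_norm.
rewrite ltr_pdivlMr // in he; apply: le_lt_trans he.
by rewrite ler_pM2l // ler_nat ltnW // ltnS ltnW.
Qed.

End LabelPath.

(** * Krylov and companion matrices, and a section of the spectrum map *)

Section SpectralSection.
Variables (R : realType) (n : nat).
Implicit Types (A K : 'M[R[i]]_n.+1) (x : 'I_n.+1 -> R[i]).

(** Invertible exactly when the last basis row vector is cyclic for [A]; it is then the change of
    basis to companion form. *)
Definition krylov (F : comNzRingType) (A : 'M[F]_n.+1) : 'M[F]_n.+1 :=
  \matrix_i (delta_mx 0 ord_max *m A ^+ i).

(* Its last basis row vector is cyclic, and it keeps lower triangular matrices
   lower triangular with the same diagonal when added to them. *)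
Definition subdiag (F : comNzRingType) : 'M[F]_n.+1 :=
  \matrix_(i, j) (i == j.+1 :> nat)%:R.

(** Only the coefficients of the product enter, so the matrix is symmetric in the labels and
    continuous in them. *)
Definition companion x : 'M[R[i]]_n.+1 :=
  \matrix_(i, j) if (i == n :> nat) then - (\prod_k ('X - (x k)%:P))`_j
                 else (i.+1 == j :> nat)%:R.

Lemma size_prod_lines x : size (\prod_k ('X - (x k)%:P)) = n.+2.
Proof. by rewrite -big_enum /= size_prod_XsubC size_enum_ord. Qed.

Lemma companion_spec x : has_spec (companion x) x.
Proof.
rewrite /has_spec /companion; set p := \prod_k _.
have pm : p \is monic by apply: monic_prod_XsubC.
have sp : (size p).-1 = n.+1 by rewrite size_prod_lines.
rewrite -[RHS](companionmxK pm) /companionmx.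
have -> : n = (size p).-1.-1 by rewrite sp.
by move: (size p).-1 sp => d ->.
Qed.

Lemma companion_perm x (s : 'S_n.+1) : companion (x \o s) = companion x.
Proof. by rewrite /companion [in RHS](reindex_inj (@perm_inj _ s)). Qed.

(** Multiplication by [A] shifts the Krylov rows, and Cayley-Hamilton expresses the row that is
    shifted out by the others. *)
Lemma krylov_companion A x : has_spec A x ->
  krylov A *m A = companion x *m krylov A.
Proof.
move=> Ax; apply/row_matrixP => i; rewrite !row_mul rowK.
rewrite -mulmxA -[_ *m A]/(_ * A) -exprSr.
have [|ni] := eqVneq (i : nat) n; last first.
  have i1 : (i.+1 < n.+1)%N by rewrite ltn_neqAle eqSS ni ltn_ord.
  have -> : row i (companion x) = delta_mx 0 (Ordinal i1).
    by apply/rowP => j; rewrite !mxE (negPf ni) eqxx -val_eqE /= eq_sym.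
  by rewrite -[RHS]rowE rowK.
move=> ni; pose p := \prod_k ('X - (x k)%:P); have Ap : char_poly A = p := Ax.
have pn : p`_n.+1 = 1.
  have /monicP : p \is monic by apply: monic_prod_XsubC.
  by rewrite lead_coefE size_prod_lines.
have : horner_mx A p = \sum_(j < n.+2) p`_j *: A ^+ j.
  rewrite -[in LHS](coefK p) poly_def size_prod_lines raddf_sum /=.
  by apply: eq_bigr => j _; rewrite linearZ /= rmorphXn /= horner_mx_X.
rewrite -{1}Ap Cayley_Hamilton big_ord_recr /= pn scale1r => /esym/eqP.
rewrite addrC addr_eq0 ni => /eqP ->.
rewrite mulmxN mulmx_sumr mulmx_sum_row -sumrN; apply: eq_bigr => j _.
by rewrite rowK !mxE ni eqxx -scalemxAr scaleNr.
Qed.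

Lemma krylov_scale A (c : R[i]) : c != 0 ->
  krylov A \in unitmx -> krylov (c *: A) \in unitmx.
Proof.
move=> c0 Ku; have -> : krylov (c *: A) = diag_mx (\row_i c ^+ i) *m krylov A.
  apply/row_matrixP => i; rewrite rowK row_mul row_diag_mx -scalemxAl -[delta_mx 0 i *m _]rowE rowK mxE.
  by rewrite exprZn -scalemxAr.
rewrite unitmx_mul Ku andbT unitmxE det_diag unitfE.
by apply/prodf_neq0 => i _; rewrite mxE expf_neq0.
Qed.

Lemma krylov_subdiag : krylov (subdiag R[i]) \in unitmx.
Proof.
have pow (i : nat) : (i < n.+1)%N ->
    delta_mx (0 : 'I_1) ord_max *m subdiag R[i] ^+ i = delta_mx 0 (inord (n - i)).
  elim: i => [_|i IH ilt].
    by rewrite expr0 mulmx1 subn0; congr delta_mx; apply/val_inj; rewrite /= inordK.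
  rewrite exprSr mulmxA IH; last exact: ltnW.
  rewrite -rowE; apply/rowP => j; rewrite !mxE eqxx -val_eqE /=.
  rewrite !inordK ?ltnS ?leq_subr //; congr (nat_of_bool _)%:R.
  by rewrite -(eqn_add2r 1) ; apply/eqP/eqP; lia.
have -> : krylov (subdiag R[i]) = perm_mx (perm (@rev_ord_inj n.+1)).
  apply/row_matrixP => i; rewrite rowK pow //; apply/rowP => j.
  rewrite !mxE permE eqxx -!val_eqE /= inordK ?ltnS ?leq_subr //.
  by rewrite subSS eq_sym.
exact: unitmx_perm.
Qed.

(** The Krylov determinant of [z *: A + subdiag] is a polynomial in [z], nonzero at 0. A large real
    [t] that is not a root gives [h = t^-1], because cyclicity survives scaling. *)
Lemma cyclic_perturbation A (e : R) : 0 < e ->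
  exists2 h : R, 0 < h < e & krylov (A + h%:C *: subdiag R[i]) \in unitmx.
Proof.
move=> e0; pose d := \det (krylov ('X *: map_mx polyC A + subdiag {poly R[i]})).
have dE z : d.[z] = \det (krylov (z *: A + subdiag R[i])).
  rewrite -[_.[z]]/(horner_eval z _) -det_map_mx; congr (\det _).
  have -> : z *: A + subdiag R[i] =
      map_mx (horner_eval z) ('X *: map_mx polyC A + subdiag {poly R[i]}).
    apply/matrixP => i j; rewrite !mxE /= /horner_eval !hornerE.
    by case: eqP => _; rewrite ?hornerC.
  apply/row_matrixP => i; rewrite rowK -map_row rowK map_mxM map_delta_mx.
  by rewrite -rmorphXn.
have d0 : d != 0.
  apply: contraTneq krylov_subdiag => d0; rewrite unitmxE unitfE.
  by have := dE 0; rewrite scale0r add0r d0 horner0 => <-; rewrite eqxx.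
have et1 : e^-1 < e^-1 + 1 by rewrite ltrDl.
have [t /andP[et _] dt] := exists_nonroot d0 et1.
have t0 : 0 < t by apply: lt_trans et; rewrite invr_gt0.
have tC0 : t%:C != 0 by rewrite (inj_eq (@complexI R)) gt_eqF.
exists t^-1; first by rewrite invr_gt0 t0 -[e]invrK ltf_pV2 ?posrE ?invr_gt0.
rewrite fmorphV (_ : A + _ = (t%:C)^-1 *: (t%:C *: A + subdiag R[i])); last first.
  by rewrite scalerDr scalerA mulVf // scale1r.
by apply: krylov_scale; rewrite ?invr_eq0 // unitmxE unitfE -dE.
Qed.

Lemma cvg_coef_prod_lines (T : Type) (F : set_system T) {FF : Filter F}
    (q : 'I_n.+1 -> T -> R[i]) (y : 'I_n.+1 -> R[i]) k :
  (forall j, q j @ F --> y j) ->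
  (fun t => (\prod_j ('X - (q j t)%:P))`_k) @ F --> (\prod_j ('X - (y j)%:P))`_k.
Proof.
move=> qy; elim: (index_enum _) k => [|j r IH] k.
  by rewrite big_nil; under eq_fun do rewrite big_nil; apply: cvg_const.
rewrite big_cons mulrBl coefB coefXM coefCM.
under eq_fun do rewrite big_cons mulrBl coefB coefXM coefCM.
apply: cvg_sub; last exact: cvg_mul (qy j) (IH k).
by case: k => [|k] /=; [apply: cvg_const|apply: IH].
Qed.

(* A continuous section, near M, of the map sending a matrix to its spectrum.
   Since it is symmetric, eigenvalues can be permuted by a path of matrices
   which ends where it starts. *)
Lemma spectral_section (M : 'M[R[i]]_n.+1) (m : 'I_n.+1 -> R[i]) (e : R) :
  has_spec M m -> 0 < e -> exists S : ('I_n.+1 -> R[i]) -> 'M[R[i]]_n.+1,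
    [/\ forall x, has_spec (S x) x,
        forall x (s : 'S_n.+1), S (x \o s) = S x,
        rnorm (S m - M) < e,
        forall z, has_spec (M + z *: (S m - M)) m &
        forall (T : Type) (F : set_system T) (FF : Filter F)
          (q : 'I_n.+1 -> T -> R[i]) (y : 'I_n.+1 -> R[i]),
          (forall j, q j @ F --> y j) -> (fun t => S (q^~ t)) @ F --> S y].
Proof.
(* After Schur triangularization the spectrum sits on the diagonal, which no multiple of [subdiag]
   disturbs. *)
move=> Mm e0; have [P Punitary] := Schur M (ltn0Sn n).
have Pu := unitarymx_unit Punitary.
rewrite /similar_to conjumx //= => Ttrig; set A := P *m M *m invmx P in Ttrig.
have MA : M = invmx P *m A *m P by rewrite /A !mulmxA mulVmx // mul1mx mulmxKV.
clearbody A.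
pose N := invmx P *m subdiag R[i] *m P.
have N0 : 0 < rnorm N + 1 by rewrite ltr_wpDl ?rnorm_ge0.
have [h /andP[h0 he] Ku] := cyclic_perturbation A (divr_gt0 e0 N0).
set Ah := A + h%:C *: subdiag R[i] in Ku; set K := krylov Ah in Ku.
have subspec c : has_spec (A + c *: subdiag R[i]) m.
  have AE : char_poly A = \prod_j ('X - (m j)%:P).
    by rewrite -Mm MA char_poly_conj.
  rewrite /has_spec -AE !char_poly_trig //; last first.
    apply/is_trig_mxP => i j ij; rewrite !mxE (is_trig_mxP Ttrig) // add0r.
    by rewrite ltn_eqF ?mulr0 // ltnW // ltnS ltnW.
  by apply: eq_bigr => i _; rewrite !mxE ltn_eqF ?mulr0 ?addr0.
have Mspec c : has_spec (M + c *: N) m.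
  rewrite /has_spec -(subspec c) -[RHS](char_poly_conj _ Pu); congr char_poly.
  by rewrite mulmxDr mulmxDl -MA -scalemxAr -scalemxAl.
(* At [x = m] the conjugation by [K] turns the companion matrix back into [Ah], so [S m] is the
   cyclic perturbation of [M]. *)
pose S x := invmx P *m (invmx K *m companion x *m K) *m P.
have Sm : S m = M + h%:C *: N.
  rewrite /S -mulmxA -(mulmxA (invmx K)) -(krylov_companion (subspec h%:C)).
  rewrite mulKmx // mulmxA mulmxDr mulmxDl -MA.
  by rewrite -scalemxAr -scalemxAl.
exists S; split.
- by move=> x; rewrite /has_spec !char_poly_conj //; apply: companion_spec.
- by move=> x s; rewrite /S companion_perm.
- rewrite Sm addrC addKr rnormZ rnormR ger0_norm ?ltW //.
  rewrite ltr_pdivlMr // in he; apply: le_lt_trans he.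
  by rewrite ler_pM2l // lerDl.
- by move=> z; rewrite Sm [_ - M]addrC addKr scalerA; apply: Mspec.
move=> T F FF q y qy.
have cc : (fun t => companion (q^~ t)) @ F --> companion y.
  apply/cvg_mxP => i j; rewrite mxE; under eq_fun do rewrite mxE.
  case: eqP => _; last exact: cvg_const.
  exact (cvg_opp (@cvg_coef_prod_lines T F FF q y j qy)).
exact (cvg_mulmx (cvg_mulmx (cvg_const _)
  (cvg_mulmx (cvg_mulmx (cvg_const _) cc) (cvg_const _))) (cvg_const _)).
Qed.

End SpectralSection.

(** * Paths of matrices with labelled spectra *)

Section Tracks.
Variables (R : realType) (n : nat).
Implicit Types (A X Y Z M : 'M[R[i]]_n) (x y z m : 'I_n -> R[i]).

Definition simple_near M m (e : R) A x : Prop :=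
  [/\ has_spec A x, injective x, rnorm (M - A) < e &
      forall j, rnorm (m j - x j) < e].

Lemma simple_near_shift M m M' m' (d e : R) A x :
  rnorm (M' - M) < d -> (forall j, rnorm (m' j - m j) < d) ->
  simple_near M m e A x -> simple_near M' m' (d + e) A x.
Proof.
move=> MM' mm' [Ax xinj MA mx]; split=> // [|j].
  by apply: le_lt_trans (rdistD M _ _) _; apply: ltrD.
by apply: le_lt_trans (rdistD (m j) _ _) _; apply: ltrD.
Qed.

Lemma simple_near_le M m (d e : R) A x :
  d <= e -> simple_near M m d A x -> simple_near M m e A x.
Proof.
move=> de [Ax xinj MA mx]; split=> // [|j]; first exact: lt_le_trans de.
exact: lt_le_trans (mx j) de.
Qed.

(** The condition [G] may depend on time because the final path follows a moving matrix [C s]; local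
    pieces are built with it frozen. *)
Definition track (G : R -> 'M[R[i]]_n -> ('I_n -> R[i]) -> Prop) (a b : R)
    X x Y y : Prop :=
  exists P : R -> 'M[R[i]]_n, exists p : 'I_n -> R -> R[i],
    [/\ continuous P, forall j, continuous (p j), P a = X /\ p^~ a = x,
        P b = Y /\ p^~ b = y & forall s, a <= s <= b -> G s (P s) (p^~ s)].

Lemma track_refl G a X x : G a X x -> track G a a X x X x.
Proof.
move=> GXx; exists (fun=> X), (fun j _ => x j); split => //.
- by move=> s; apply: cvg_const.
- by move=> j s; apply: cvg_const.
by move=> s; rewrite -eq_le => /eqP <-.
Qed.

Lemma track_trans G a b c X x Y y Z z : a <= b -> b <= c ->
  track G a b X x Y y -> track G b c Y y Z z -> track G a c X x Z z.
Proof.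
move=> ab bc [P [p [Pc pc [Pa pa] [Pb pb] PG]]] [Q [q [Qc qc [Qb qb] [Qc' qc'] QG]]].
have PQ : P b = Q b by rewrite Pb Qb.
have pq j : p j b = q j b by rewrite -[LHS]/(p^~ b j) pb -qb.
exists (splice b P Q), (fun j => splice b (p j) (q j)).
have gL s : s <= b -> (fun j => splice b (p j) (q j) s) = p^~ s.
  by move=> sb; apply/funext => j; rewrite spliceL.
have gR s : b <= s -> (fun j => splice b (p j) (q j) s) = q^~ s.
  by move=> bs; apply/funext => j; rewrite spliceR.
split.
- exact (@continuous_splice R 'M[R[i]]_n b P Q Pc Qc).
- by move=> j; exact (@continuous_splice R R[i] b (p j) (q j) (pc j) (qc j)).
- by rewrite spliceL // gL.
- by rewrite spliceR // gR.
move=> s /andP[as_ sc]; have [sb|bs] := leP s b.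
  by rewrite spliceL // gL //; apply: PG; rewrite as_.
by rewrite spliceR ?ltW // gR ?ltW //; apply: QG; rewrite ltW.
Qed.

Lemma track_sub G G' a b X x Y y :
  (forall s A z, a <= s <= b -> G s A z -> G' s A z) ->
  track G a b X x Y y -> track G' a b X x Y y.
Proof.
move=> GG' [P [p [Pc pc Pa Pb PG]]]; exists P, p; split => // s sab.
by apply: GG' (PG s sab).
Qed.

Lemma continuous_affine (c d : R) : continuous (fun s : R => c + s * d).
Proof.
move=> s; apply: cvgD; first exact: cvg_cst.
by apply: cvgM; [exact: cvg_id|exact: cvg_cst].
Qed.

Lemma track_rescale (G : 'M[R[i]]_n -> ('I_n -> R[i]) -> Prop) (a b c d : R)
    X x Y y :
  c < d -> a < b -> track (fun=> G) a b X x Y y -> track (fun=> G) c d X x Y y.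
Proof.
move=> cd ab [P [p [Pc pc [Pa pa] [Pb pb] PG]]].
pose k := (b - a) / (d - c); pose u s := a - c * k + s * k.
have k0 : 0 < k by rewrite divr_gt0 ?subr_gt0.
have kE : d * k = b - a + c * k.
  by rewrite /k; field; rewrite subr_eq0 gt_eqF.
have uc : u c = a by rewrite /u; ring.
have ud : u d = b by rewrite /u kE; ring.
exists (P \o u), (fun j => p j \o u); split.
- by move=> s; apply: continuous_comp; [apply: continuous_affine|apply: Pc].
- by move=> j s; apply: continuous_comp; [apply: continuous_affine|apply: pc].
- by rewrite /= uc.
- by rewrite /= ud.
move=> s /andP[cs sd]; apply: (PG (u s)).
have h1 : c * k <= s * k by rewrite ler_pM2r.
have h2 : s * k <= d * k by rewrite ler_pM2r.
by rewrite /u; apply/andP; split; lra.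
Qed.

Lemma track_rev (G : 'M[R[i]]_n -> ('I_n -> R[i]) -> Prop) X x Y y :
  track (fun=> G) 0 1 X x Y y -> track (fun=> G) 0 1 Y y X x.
Proof.
move=> [P [p [Pc pc [Pa pa] [Pb pb] PG]]].
pose u (s : R) := 1 + s * -1.
have u0 : u 0 = 1 by rewrite /u; ring.
have u1 : u 1 = 0 by rewrite /u; ring.
exists (P \o u), (fun j => p j \o u); split.
- by move=> s; apply: continuous_comp; [apply: continuous_affine|apply: Pc].
- by move=> j s; apply: continuous_comp; [apply: continuous_affine|apply: pc].
- by rewrite /= u0.
- by rewrite /= u1.
by move=> s s01; apply: (PG (u s)); rewrite /u; lra.
Qed.

End Tracks.

Lemma near_rnormP (R : realType) (V : normedModType R[i]) (x : V)
    (Q : V -> Prop) :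
  (\forall t \near x, Q t) ->
  exists2 d : R, 0 < d & forall t, rnorm (x - t) < d -> Q t.
Proof.
move=> /nbhs_normP[/= d d0 dQ]; exists (complex.Re d).
  by move: d0; rewrite ltcE => /andP[].
move=> t xt; apply: dQ; rewrite /ball_ /= rnormE.
suff -> : d = (complex.Re d)%:C by rewrite ltcR.
by move: d0; rewrite ltcE; case: (d) => a b /= /andP[/eqP ->].
Qed.

(** Applying the filter form of continuity to the neighbourhoods of the row vector with entries
    [m j] gives one bound for all labels at once. *)
Lemma section_modulus (R : realType) (n : nat)
    (S : ('I_n -> R[i]) -> 'M[R[i]]_n) (m : 'I_n -> R[i]) (e : R) :
  (forall (T : Type) (F : set_system T) (FF : Filter F)
     (q : 'I_n -> T -> R[i]) (y : 'I_n -> R[i]),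
     (forall j, q j @ F --> y j) -> (fun t => S (q^~ t)) @ F --> S y) ->
  0 < e -> exists2 d : R, 0 < d &
    forall x, (forall j, rnorm (m j - x j) < d) -> rnorm (S m - S x) < e.
Proof.
move=> Scont e0; pose v : 'rV[R[i]]_n := \row_j m j.
have /cvg_rnorm/(_ e e0) : (fun t : 'rV[R[i]]_n => S (t 0)) @ v --> S m.
  apply: (Scont _ (nbhs v) (nbhs_filter v) (fun j (t : 'rV[R[i]]_n) => t 0 j)) => j.
  have /cvg_mxP/(_ 0 j) : (id : 'rV[R[i]]_n -> 'rV[R[i]]_n) @ v --> v.
    exact: cvg_id.
  by rewrite mxE.
move=> /near_rnormP[d d0 hd]; exists d => // x mx.
have := hd (\row_j x j); rewrite (_ : (\row_j x j) 0 = x); last first.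
  by apply/funext => j; rewrite mxE.
apply; apply/rnorm_mx_lt => // i j; rewrite !mxE; exact: mx.
Qed.

(** * Joining nearby matrices and the main construction *)

Section Connection.
Variables (R : realType) (n : nat).
Implicit Types (X Y Z M : 'M[R[i]]_n.+1) (x y z m : 'I_n.+1 -> R[i]).

(** The section [S] is evaluated at distinct labels close to [m]. *)
Lemma simple_near_exists M m (e : R) : has_spec M m -> 0 < e ->
  exists Y, exists y, simple_near M m e Y y.
Proof.
move=> Mm e0; have e20 : 0 < e / 2 by rewrite divr_gt0.
have [S [Sspec _ SM _ Scont]] := spectral_section Mm e20.
have [d d0 Sd] := section_modulus m Scont e20.
have [|y yinj ym] := @near_injective R _ m (Num.min d e).
  by rewrite lt_min d0.
have my j : rnorm (m j - y j) < d /\ rnorm (m j - y j) < e.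
  by have := ym j; rewrite rdistC lt_min => /andP[].
exists (S y), y; split => //; last by move=> j; have [] := my j.
apply: le_lt_trans (rdistD (S m) _ _) _; rewrite [e]splitr ltrD //.
  by rewrite rdistC.
by apply: Sd => j; have [] := my j.
Qed.

(* Run along a complex line from X to Z := S z0, avoiding the discriminant. This
   brings the labels x to a permutation of z0, which is undone by moving the
   argument of the symmetric section S. The line stays near the line from M to
   S m, on which the spectrum is constantly m. *)
Lemma connect_base M m (e : R) : has_spec M m -> 0 < e ->
  exists2 d : R, 0 < d & exists Z, exists z0, forall X x,
    simple_near M m d X x -> track (fun=> simple_near M m e) 0 1 X x Z z0.
Proof.
move=> Mm e0; have e160 : 0 < e / 16 by rewrite divr_gt0.
have [S [Sspec Sperm SM Mline Scont]] := spectral_section Mm e160.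
have [dS dS0 Snear] := section_modulus m Scont e160.
pose N : R := n.+1%:R; have N1 : 1 <= N by rewrite ler1n.
pose k := Num.min dS e; have k0 : 0 < k by rewrite lt_min dS0.
have kdS : k <= dS by rewrite ge_min lexx.
have ke : k <= e by rewrite ge_min lexx orbT.
have N14 : 0 < 14 * N + 1 by lra.
(* This is the budget for [q_m]: the labels [q] stray from [m] by less than [9 * N * e1 + 5 * e1],
   which is below [k]. *)
pose e1 := k / (14 * N + 1); have e10 : 0 < e1 by rewrite divr_gt0.
have ke1 : k = 14 * (N * e1) + e1.
  by rewrite /e1; field; rewrite gt_eqF.
have e1N : e1 <= N * e1 by rewrite ler_peMl // ltW.
have [d1 d10 roots_near] := @char_roots_near R n.+1 (rnorm M + e) e1 e10.
have d180 : 0 < d1 / 8 by rewrite divr_gt0.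
have [dz dz0 Sz] := section_modulus m Scont d180.
have [|z0 z0inj z0m] := @near_injective R _ m (Num.min e1 dz).
  by rewrite lt_min e10.
have mz0 j : rnorm (m j - z0 j) < e1 by have := z0m j; rewrite rdistC lt_min => /andP[].
have mz0' j : rnorm (m j - z0 j) < dz by have := z0m j; rewrite rdistC lt_min => /andP[].
have SmZ : rnorm (S m - S z0) < d1 / 8 by apply: Sz.
have SmZe : rnorm (S m - S z0) < e / 16 by apply: Snear => j; have := mz0 j; lra.
(* In [P_line] the total is below five times [d1 / 8], and in [P_M] below seven times [e / 16], the
   parameter [w] having modulus at most 2. *)
exists (Num.min e1 (Num.min (d1 / 8) (e / 16))).
  by rewrite !lt_min e10 d180.
exists (S z0), z0 => X x [Xx xinj XM xm].
have [XM1 XMe] : rnorm (M - X) < d1 / 8 /\ rnorm (M - X) < e / 16.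
  by move: XM; rewrite !lt_min => /and3P[].
have {}xm j : rnorm (m j - x j) < e1 by have := xm j; rewrite lt_min => /andP[].
have [D Dsep] := discriminant_line X (S z0).
have [||w [wc w0 w1 wD]] := @path_avoiding_roots R D.
- by rewrite Dsep scale0r addr0; apply/(separable_char_poly Xx).
- by rewrite Dsep scale1r addrC subrK; apply/(separable_char_poly (Sspec z0)).
pose P s := X + w s *: (S z0 - X).
have Pc : continuous P.
  by move=> s; exact (cvg_add (cvg_const X) (cvg_scale (x := S z0 - X) (wc s))).
have P0 : P 0 = X by rewrite /P w0 scale0r addr0.
have P1 : P 1 = S z0 by rewrite /P w1 scale1r addrC subrK.
have Psep s : 0 <= s <= 1 -> separable_poly (char_poly (P s)).
  by move=> /wD[]; rewrite Dsep.
have [p [pc p0 pP]] : exists p : 'I_n.+1 -> R -> R[i],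
    [/\ forall j, continuous (p j), forall j, p j 0 = x j &
        forall s, 0 <= s <= 1 -> has_spec (P s) (p^~ s)].
  by apply: eigenpaths_exist => //; rewrite P0.
have P_M s : 0 <= s <= 1 -> rnorm (M - P s) < e.
  move=> /wD[_ w2]; have -> : M - P s = (M - X) + w s *: (X - S z0).
    by rewrite /P -(opprB (S z0)) scalerN opprD addrA.
  apply: le_lt_trans (rnormD _ _) _; rewrite rnormZ.
  have XZ : rnorm (X - S z0) <= rnorm (M - X) + rnorm (S m - M) + rnorm (S m - S z0).
    apply: le_trans (rdistD (S m) _ _) _; rewrite lerD2r.
    by apply: le_trans (rdistD M _ _) _; rewrite rdistC lerD2l rdistC.
  have : rnorm (w s) * rnorm (X - S z0) <= 2 * rnorm (X - S z0).
    by rewrite ler_wpM2r ?rnorm_ge0.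
  by lra.
have P_line s : 0 <= s <= 1 -> rnorm ((M + w s *: (S m - M)) - P s) < d1.
  move=> /wD[_ w2].
  have -> : M + w s *: (S m - M) - P s =
      (M - X) - w s *: (M - X) + w s *: (S m - S z0).
    by rewrite /P; apply/matrixP => i j; rewrite !mxE; ring.
  apply: le_lt_trans (rnormD _ _) _.
  have := rnormD (M - X) (- (w s *: (M - X))); rewrite rnormN !rnormZ.
  have : rnorm (w s) * rnorm (M - X) <= 2 * rnorm (M - X).
    by rewrite ler_wpM2r ?rnorm_ge0.
  have : rnorm (w s) * rnorm (S m - S z0) <= 2 * rnorm (S m - S z0).
    by rewrite ler_wpM2r ?rnorm_ge0.
  by lra.
have line_M s : 0 <= s <= 1 -> rnorm (M + w s *: (S m - M)) <= rnorm M + e.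
  move=> /wD[_ w2]; apply: le_trans (rnormD _ _) _; rewrite rnormZ lerD2l.
  have : rnorm (w s) * rnorm (S m - M) <= 2 * rnorm (S m - M).
    by rewrite ler_wpM2r ?rnorm_ge0.
  by lra.
(* The comparison matrix [M + w t *: (S m - M)] has spectrum [m], so each eigenvalue of [P t] stays
   in the discs of radius [e1] around [m], and [trapped_path_dist] bounds its drift even if it
   changes disc. *)
have p_m j s : 0 <= s <= 1 -> rnorm (m j - p j s) < 3 * (N * e1) + e1.
  move=> s01; have := @trapped_path_dist R n.+1 m e1 0 1 (p j) (pc j).
  rewrite p0 -/N -mulrA => trapped.
  apply: le_lt_trans (rdistD (x j) _ _) _; rewrite [ltRHS]addrC.
  apply: ltr_leD (xm j) _; rewrite rdistC; apply: trapped => // t t01.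
  apply: (roots_near (M + w t *: (S m - M)) (P t)); [exact: line_M|exact: P_line|exact: Mline|].
  exact: (has_spec_root j (pP t t01)).
have track1 : track (fun=> simple_near M m e) 0 1 X x (S z0) (p^~ 1).
  exists P, p; split => //; first by split=> //; apply/funext.
  move=> s s01; split.
  - exact: pP.
  - by apply/(separable_char_poly (pP s s01)); apply: Psep.
  - exact: P_M.
  - by move=> j; have := p_m j s s01; lra.
have i01 : 0 <= (1 : R) <= 1 by rewrite ler01 lexx.
have Zp : has_spec (S z0) (p^~ 1) by rewrite -P1; apply: pP.
have [t pt] := has_spec_unique Zp (Sspec z0).
have pinj : injective (p^~ 1).
  by move=> i j; rewrite !pt => /z0inj/perm_inj.
have [q [qc q0 q1 qs]] := label_path pinj z0inj.
have q_m j s : 0 <= s <= 1 -> rnorm (m j - q j s) < k.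
  move=> /qs[_ /(_ j) qp].
  have h1 := p_m j 1 i01; have h2 := mz0 j.
  have h3 := rdistD (m j) (z0 j) (p j 1); rewrite (rdistC (z0 j) (m j)) in h3.
  have h4 := rdistD (p j 1) (m j) (q j s); rewrite (rdistC (p j 1)) in h4.
  by rewrite ke1; lra.
(* The labels move from [z0 \o t] to [z0] while the matrix runs through a loop, since
   [S (z0 \o t) = S z0]. *)
have track2 : track (fun=> simple_near M m e) 0 1 (S z0) (p^~ 1) (S z0) z0.
  exists (fun s => S (q^~ s)), q; split.
  - by move=> s; apply: (Scont _ (nbhs s) (nbhs_filter s)) => j; apply: qc.
  - exact: qc.
  - have -> : q^~ 0 = z0 \o t by apply/funext => j; rewrite /= q0 pt.
    split; first exact: Sperm.
    by apply/funext => j; rewrite /= -pt.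
  - by have -> : q^~ 1 = z0 by apply/funext.
  move=> s s01; split; [exact: Sspec|by have [] := qs s s01| |].
    apply: le_lt_trans (rdistD (S m) _ _) _.
    have : rnorm (S m - S (q^~ s)) < e / 16.
      by apply: Snear => j; apply: lt_le_trans kdS; apply: q_m.
    by rewrite (rdistC M); lra.
  by move=> j; apply: lt_le_trans ke; apply: q_m.
apply: (@track_rescale _ _ _ 0 2) => //.
apply: (@track_trans _ _ _ 0 1 2 _ _ (S z0) (p^~ 1)) => //; first by rewrite ler1n.
by apply: track_rescale track2; rewrite ?ltr1n.
Qed.

Lemma connect_near M m (e : R) : has_spec M m -> 0 < e ->
  exists2 d : R, 0 < d & forall X x Y y,
    simple_near M m d X x -> simple_near M m d Y y ->
    track (fun=> simple_near M m e) 0 1 X x Y y.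
Proof.
move=> Mm e0; have [d d0 [Z [z0 h]]] := connect_base Mm e0.
exists d => // X x Y y /h XZ /h /track_rev ZY.
apply: (@track_rescale _ _ _ 0 2) => //.
apply: (@track_trans _ _ _ 0 1 2 _ _ Z z0) => //; first by rewrite ler1n.
by apply: track_rescale ZY; rewrite ?ltr1n.
Qed.

Lemma simple_track (e : R) (C : R -> 'M[R[i]]_n.+1)
    (gamma : 'I_n.+1 -> R -> R[i]) :
  0 < e -> continuous C -> (forall j, continuous (gamma j)) ->
  (forall s, 0 <= s <= 1 -> has_spec (C s) (gamma^~ s)) ->
  exists X, exists x, exists Y, exists y,
    track (fun s => simple_near (C s) (gamma^~ s) e) 0 1 X x Y y.
Proof.
move=> e0 Cc gc Cg; pose G s := simple_near (C s) (gamma^~ s).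
(* Any accuracy [h] at [v] is attainable from a sufficient accuracy [d] at [u]. This makes [Q]
   transitive: what the right piece demands at its start is the accuracy requested of the left piece
   at its end. *)
pose Q u v := forall h, 0 < h -> exists2 d : R, 0 < d &
  forall X x, G u d X x -> exists Y, exists y,
    G v h Y y /\ track (fun s => G s e) u v X x Y y.
suff /(_ 1 ltr01)[d d0 hd] : Q 0 1.
  have i00 : 0 <= (0 : R) <= 1 by rewrite lexx ler01.
  have [X [x /hd[Y [y [_ XY]]]]] := simple_near_exists (Cg 0 i00) d0.
  by exists X, x, Y, y.
apply: interval_induction => // [u v w /andP[_ uv] /andP[vw _] Quv Qvw h h0|t t01].
  have [d d0 hd] := Qvw h h0; have [d' d'0 hd'] := Quv d d0.
  exists d' => // X x /hd'[Y [y [/hd[Z [z [Zh YZ]]] XY]]].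
  by exists Z, z; split => //; apply: track_trans XY YZ.
have e20 : 0 < e / 2 by rewrite divr_gt0.
have [d d0 conn] := connect_near (Cg t t01) e20.
pose k := Num.min (e / 2) (d / 2).
have k0 : 0 < k by rewrite lt_min e20 divr_gt0.
have ke : k <= e / 2 by rewrite ge_min lexx.
have kd : k <= d / 2 by rewrite ge_min lexx orbT.
have [r r0 Cr] := continuous_nearP (@Cc t) k0.
have /choice[rg hrg] : forall j, exists r : R, 0 < r /\
    forall s, `|t - s| < r -> rnorm (gamma j t - gamma j s) < k.
  by move=> j; have [r' r'0 hr'] := continuous_nearP (@gc j t) k0; exists r'.
have [r' r'0 r'rg] := finite_pos_lb (fun j => (hrg j).1).
exists (Num.min r r'); first by rewrite lt_min r0.
move=> u v /andP[u0 ut] /andP[tv v1] tru vtr h h0.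
have near s : u <= s <= v -> rnorm (C t - C s) < k /\
    forall j, rnorm (gamma j t - gamma j s) < k.
  move=> /andP[us sv]; have : `|t - s| < Num.min r r'.
    by rewrite ltr_norml; apply/andP; split; lra.
  rewrite lt_min => /andP[tsr tsr']; split; first exact: Cr.
  by move=> j; apply: (hrg j).2; apply: lt_le_trans tsr' (r'rg j).
have uv := le_trans ut tv.
(* Rescaling needs an interval of positive length; a degenerate one is served by a constant
   track. *)
have [uv_eq|uv_neq] := eqVneq u v.
  exists (Num.min h e) => [|X x Xx]; first by rewrite lt_min h0.
  exists X, x; rewrite -uv_eq; split.
    by apply: simple_near_le Xx; rewrite ge_min lexx.
  by apply: track_refl; apply: simple_near_le Xx; rewrite ge_min lexx orbT.
have d20 : 0 < d / 2 by rewrite divr_gt0.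
have hd0 : 0 < Num.min h (d / 2) by rewrite lt_min h0.
have v01 : 0 <= v <= 1 by apply/andP; split; lra.
have [Y [y Yy]] := simple_near_exists (Cg v v01) hd0.
have shift s A z : u <= s <= v -> G s (d / 2) A z -> G t d A z.
  move=> suv Az; have [Cs gs] := near s suv; rewrite [d]splitr.
  apply: simple_near_shift Az; first exact: lt_le_trans Cs kd.
  by move=> j; apply: lt_le_trans (gs j) kd.
exists (d / 2) => // X x Xx; exists Y, y; split.
  by apply: simple_near_le Yy; rewrite ge_min lexx.
apply: (@track_sub _ _ (fun=> G t (e / 2))) => [s A z suv Az|].
  have [Cs gs] := near s suv; rewrite [e]splitr.
  apply: simple_near_shift Az; first by rewrite rdistC; apply: lt_le_trans Cs ke.
  by move=> j; rewrite rdistC; apply: lt_le_trans (gs j) ke.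
apply: (@track_rescale _ _ _ 0 1) => //; first by rewrite lt_neqAle uv_neq.
apply: conn; first by apply: shift Xx; rewrite lexx.
apply: (shift v); first by rewrite lexx uv.
by apply: simple_near_le Yy; rewrite ge_min lexx orbT.
Qed.

End Connection.

(** * Passage to paths on the unit interval *)

Lemma continuous_clamp_comp (R : realType) (V : topologicalType) (a b : R)
    (f : R -> V) :
  a <= b -> {within `[a, b], continuous f} -> continuous (f \o clamp a b).
Proof.
move=> ab /subspace_continuousP fc s.
have sab : clamp a b s \in `[a, b] by rewrite in_itv /= clamp_itv.
apply: cvg_trans (fc (clamp a b s) sab) => U.
rewrite /within /= => h.
have cl : clamp a b @ s --> clamp a b s by apply: continuous_clamp.
apply: (@filterS _ (nbhs s) _ _ _ _ (cl _ h)) => t /= ht; apply: ht.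
by rewrite /= in_itv /= clamp_itv.
Qed.

Theorem theorem2 (R : realType) (n : nat) (eps : R) (C : R -> 'M[R[i]]_n)
    (gamma : 'I_n -> R -> R[i]) :
  0 < eps -> matrix_path C -> eigenpath_set C gamma ->
  exists (C' : R -> 'M[R[i]]_n) (gamma' : 'I_n -> R -> R[i]),
    [/\ matrix_path C',
        unique_eigenpath_set C' gamma' &
        forall a : R, a \in `[0, 1] ->
          `|C a - C' a| < eps%:C /\
          forall j : 'I_n, `|gamma j a - gamma' j a| < eps%:C].
Proof.
move=> eps0 Cpath Cgamma; case: n => [|n] in C gamma Cpath Cgamma *.
  (* In dimension 0 there are no eigenpaths, and [C] itself serves. *)
  exists C, gamma; split => //.
    by split=> // eta _; exists 1%g => -[].
  by move=> a _; split=> [|[]//]; rewrite subrr normr0 ltcR.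
have [gc Cg] := Cgamma.
have [||s s01|X [x [Y [y [P [p [Pc pc _ _ PG]]]]]]] :=
  @simple_track R n eps (C \o clamp 0 1) (fun j => gamma j \o clamp 0 1) eps0.
- exact: continuous_clamp_comp.
- by move=> j; apply: continuous_clamp_comp.
- apply/has_spec_spectrum => /=; rewrite clamp_id //.
  by apply: Cg; rewrite in_itv.
exists P, p; split.
- exact: continuous_subspaceT.
- split; first split.
  + by move=> j; apply: continuous_subspaceT; apply: pc.
  + move=> a; rewrite in_itv /= => /PG[Pa _ _ _].
    exact/has_spec_spectrum.
  move=> eta [ec Peta].
  have Pspec a : 0 <= a <= 1 -> has_spec (P a) (p^~ a) by move=> /PG[].
  have Peta' a : 0 <= a <= 1 -> has_spec (P a) (eta^~ a).
    by move=> a01; apply/has_spec_spectrum; apply: Peta; rewrite in_itv.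
  have i00 : 0 <= (0 : R) <= 1 by rewrite lexx ler01.
  (* The permutation is read off at 0; simplicity of the spectrum along [P] propagates it to every
     [a]. *)
  have [s es] := has_spec_unique (Peta' 0 i00) (Pspec 0 i00).
  exists s => j a; rewrite in_itv /= => /andP[a0 a1].
  have sub u : 0 <= u <= a -> 0 <= u <= 1.
    by move=> /andP[-> /= /le_trans->].
  have <- : (eta j \o clamp 0 1) a = eta j a by rewrite /= clamp_id // a0.
  apply: (@selection_unique R n.+1 p _ 0 a (s j) a0) => //.
  + by apply: continuous_clamp_comp.
  + by move=> u /sub /PG[].
  + move=> u /sub u01; rewrite /= clamp_id //.
    exact: root_has_spec (Pspec u u01) (has_spec_root j (Peta' u u01)).
  by rewrite /= clamp_id // es.
move=> a; rewrite in_itv /= => a01; have [_ _] := PG a a01.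
rewrite /= clamp_id // => CP gp; rewrite rnorm_lt; split => // j.
by rewrite rnorm_lt; apply: gp.
Qed.
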